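(* Let $\mathfrak S$ be a $k$-linear Grothendieck category and let $(A,C,\psi)$ be an entwining structure over $k$. Then the category $\mathfrak S_A^C(\psi)$ of entwined comodule objects in $\mathfrak S$ over $(A,C,\psi)$ is a $k$-linear Grothendieck category.
   Context: $k$ is a field of characteristic zero and $\otimes=\otimes_k$. For $\mathcal M\in\mathfrak S$, $\mathcal M\otimes-:Mod_k\to\mathfrak S$ is the left adjoint of $\mathfrak S(\mathcal M,-):\mathfrak S\to Mod_k$; this gives a bifunctor $\mathfrak S\times Mod_k\to\mathfrak S$, exact and colimit preserving in both variables. $(A,\mu,\eta)$ is a $k$-algebra and $(C,\Delta,\epsilon)$ a $k$-coalgebra. An entwining structure $(A,C,\psi)$ is a linear map $\psi:C\otimes A\to A\otimes C$ with $\psi(C\otimes\mu)=(\mu\otimes C)(A\otimes\psi)(\psi\otimes A)$, $\psi(C\otimes\eta)=\eta\otimes C$, $(A\otimes\Delta)\psi=(\psi\otimes C)(C\otimes\psi)(\Delta\otimes A)$, $(A\otimes\epsilon)\psi=\epsilon\otimes A$ (an object in a slot of a morphism denotes the identity). A right $C$-comodule object in $\mathfrak S$ is $(\mathcal M,\Delta_{\mathcal M}:\mathcal M\to\mathcal M\otimes C)$ with $(\mathcal M\otimes\Delta)\Delta_{\mathcal M}=(\Delta_{\mathcal M}\otimes C)\Delta_{\mathcal M}$ and $(\mathcal M\otimes\epsilon)\Delta_{\mathcal M}=id$; a right $A$-module object is $(\mathcal M,\mu_{\mathcal M}:\mathcal M\otimes A\to\mathcal M)$ with $\mu_{\mathcal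 M}(\mathcal M\otimes\mu)=\mu_{\mathcal M}(\mu_{\mathcal M}\otimes A)$ and $\mu_{\mathcal M}(\mathcal M\otimes\eta)=id$. $\mathfrak S_A^C(\psi)$ has as objects the triples $(\mathcal M,\Delta_{\mathcal M},\mu_{\mathcal M})$ with both structures such that $\Delta_{\mathcal M}\mu_{\mathcal M}=(\mu_{\mathcal M}\otimes C)(\mathcal M\otimes\psi)(\Delta_{\mathcal M}\otimes A)$, and as morphisms the maps in $\mathfrak S$ preserving both structures. *)

(* Defs.v *)
From HB Require Import structures.
From mathcomp Require Import all_boot all_algebra.
From mathcomp Require Import boolp.

Set Implicit Arguments.
Unset Strict Implicit.
Unset Printing Implicit Defensive.

Import GRing.Theory.
Local Open Scope ring_scope.

Declare Scope cat_scope.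
Delimit Scope cat_scope with cat.
Local Open Scope cat_scope.

(* A k-linear category. The hom-modules live in the universe of the carriers  *)
(* of [lmodType k], so the category is locally small; the objects may live in *)
(* a larger universe.                                                         *)
Record klincat (k : fieldType) := KLinCat {
  obj :> Type;
  mor : obj -> obj -> lmodType k;
  idmor : forall X, mor X X;
  compm : forall X Y Z, mor Y Z -> mor X Y -> mor X Z;
  comp1m : forall X Y (f : mor X Y), compm (idmor Y) f = f;
  compm1 : forall X Y (f : mor X Y), compm f (idmor X) = f;
  compmA : forall X Y Z W (h : mor Z W) (g : mor Y Z) (f : mor X Y),
    compm h (compm g f) = compm (compm h g) f;
  comp_linl : forall X Y Z (f : mor X Y) (a : k) (g g' : mor Y Z),
    compm (a *: g + g') f = a *: compm g f + compm g' f;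
  comp_linr : forall X Y Z (g : mor Y Z) (a : k) (f f' : mor X Y),
    compm g (a *: f + f') = a *: compm g f + compm g f'
}.

Arguments mor {k S} X Y : rename.
Arguments idmor {k S} X : rename.
Arguments compm {k S X Y Z} g f : rename.
Notation "g \oc f" := (compm g f) (at level 40, left associativity) : cat_scope.

Section Abelian.
Variables (k : fieldType) (S : klincat k).
Implicit Types X Y Z : S.

Definition mono X Y (f : mor X Y) :=
  forall Z (g h : mor Z X), f \oc g = f \oc h -> g = h.

Definition epi X Y (f : mor X Y) :=
  forall Z (g h : mor Y Z), g \oc f = h \oc f -> g = h.

Definition is_kernel K X Y (i : mor K X) (f : mor X Y) :=
  f \oc i = 0 /\
  forall Z (g : mor Z X), f \oc g = 0 -> exists! h : mor Z K, i \oc h = g.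

Definition is_cokernel X Y Q (p : mor Y Q) (f : mor X Y) :=
  p \oc f = 0 /\
  forall Z (g : mor Y Z), g \oc f = 0 -> exists! h : mor Q Z, h \oc p = g.

Definition is_zero_object Z :=
  forall X, (forall f : mor X Z, f = 0) /\ (forall f : mor Z X, f = 0).

Definition is_biproduct X Y B (i1 : mor X B) (i2 : mor Y B)
    (p1 : mor B X) (p2 : mor B Y) :=
  [/\ p1 \oc i1 = idmor X, p2 \oc i2 = idmor Y, p1 \oc i2 = 0, p2 \oc i1 = 0
    & i1 \oc p1 + i2 \oc p2 = idmor B].

Record is_abelian : Prop := IsAbelian {
  has_zero_object : exists Z, is_zero_object Z;
  has_biproducts : forall X Y, exists B (i1 : mor X B) (i2 : mor Y B)
    (p1 : mor B X) (p2 : mor B Y), is_biproduct i1 i2 p1 p2;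
  has_kernels : forall X Y (f : mor X Y), exists K (i : mor K X),
    is_kernel i f;
  has_cokernels : forall X Y (f : mor X Y), exists Q (p : mor Y Q),
    is_cokernel p f;
  mono_normal : forall X Y (f : mor X Y), mono f ->
    exists Z (g : mor Y Z), is_kernel f g;
  epi_normal : forall X Y (f : mor X Y), epi f ->
    exists Z (g : mor Z X), is_cokernel f g
}.

Definition short_exact X Y Z (f : mor X Y) (g : mor Y Z) :=
  is_kernel f g /\ is_cokernel g f.

Definition is_generator G :=
  forall X Y (f g : mor X Y),
    (forall h : mor G X, f \oc h = g \oc h) -> f = g.

End Abelian.

(* Small colimits. "Small" means: in the universe of the carriers of the      *)
(* [lmodType]s, i.e. in the universe of the hom-modules.                      *)

Notation small := Type@{GRing.Lmodule.axioms_.u0} (only parsing).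

Record smallcat := SmallCat {
  sobj :> small;
  shom : sobj -> sobj -> small;
  sid : forall i, shom i i;
  scomp : forall i j l, shom j l -> shom i j -> shom i l;
  scomp1m : forall i j (a : shom i j), scomp (sid j) a = a;
  scompm1 : forall i j (a : shom i j), scomp a (sid i) = a;
  scompA : forall i j l m (c : shom l m) (b : shom j l) (a : shom i j),
    scomp c (scomp b a) = scomp (scomp c b) a
}.

Arguments shom {J} i j : rename.
Arguments sid {J} i : rename.
Arguments scomp {J i j l} b a : rename.

Record is_filtered (J : smallcat) : Prop := IsFiltered {
  filtered_inhabited : inhabited J;
  filtered_obj : forall i j : J, exists l, inhabited (shom i l) /\
    inhabited (shom j l);
  filtered_hom : forall (i j : J) (a b : shom i j),
    exists l (c : shom j l), scomp c a = scomp c b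
}.

Section Colimits.
Variables (k : fieldType) (S : klincat k) (J : smallcat).

Record diagram := Diagram {
  dobj :> J -> S;
  dmap : forall i j, shom i j -> mor (dobj i) (dobj j);
  dmap1 : forall i, dmap (sid i) = idmor (dobj i);
  dmapM : forall i j l (b : shom j l) (a : shom i j),
    dmap (scomp b a) = dmap b \oc dmap a
}.

Definition is_cocone (D : diagram) X (c : forall j, mor (D j) X) :=
  forall i j (a : shom i j), c j \oc dmap D a = c i.

Definition is_colimit (D : diagram) L (c : forall j, mor (D j) L) :=
  is_cocone c /\
  forall X (d : forall j, mor (D j) X), is_cocone d ->
    exists! h : mor L X, forall j, h \oc c j = d j.

Definition is_natural (D E : diagram) (t : forall j, mor (D j) (E j)) :=
  forall i j (a : shom i j), t j \oc dmap D a = dmap E a \oc t i.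

(* The functor colim : S^J -> S preserves short exact sequences; exactness in *)
(* S^J is objectwise, and u, v are the maps induced on the colimits.          *)
Definition exact_colimits :=
  forall (D E F : diagram)
    (s : forall j, mor (D j) (E j)) (t : forall j, mor (E j) (F j))
    (LD LE LF : S) (cD : forall j, mor (D j) LD) (cE : forall j, mor (E j) LE)
    (cF : forall j, mor (F j) LF) (u : mor LD LE) (v : mor LE LF),
  is_natural s -> is_natural t -> (forall j, short_exact (s j) (t j)) ->
  is_colimit cD -> is_colimit cE -> is_colimit cF ->
  (forall j, u \oc cD j = cE j \oc s j) ->
  (forall j, v \oc cE j = cF j \oc t j) ->
  short_exact u v.

End Colimits.

Definition is_cocomplete k (S : klincat k) :=
  forall (J : smallcat) (D : diagram S J),
    exists L (c : forall j, mor (D j) L), is_colimit c.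

Record is_grothendieck k (S : klincat k) : Prop := IsGrothendieck {
  grothendieck_abelian : is_abelian S;
  grothendieck_cocomplete : is_cocomplete S;
  grothendieck_filtered_exact :
    forall J : smallcat, is_filtered J -> exact_colimits S J;
  grothendieck_generator : exists G : S, is_generator G
}.

Record functor k (S T : klincat k) := Functor {
  fobj :> S -> T;
  functor_map : forall X Y, mor X Y -> mor (fobj X) (fobj Y);
  functor_map1 : forall X, functor_map (idmor X) = idmor (fobj X);
  functor_mapM : forall X Y Z (g : mor Y Z) (f : mor X Y),
    functor_map (g \oc f) = functor_map g \oc functor_map f
}.

Arguments functor_map {k S T} F {X Y} f : rename.

Record adjunction k (S T : klincat k) (F : functor S T) (G : functor T S) :=
  Adjunction {
  adj : forall X Y, mor (F X) Y -> mor X (G Y);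
  adjV : forall X Y, mor X (G Y) -> mor (F X) Y;
  adjK : forall X Y, cancel (@adj X Y) (@adjV X Y);
  adjVK : forall X Y, cancel (@adjV X Y) (@adj X Y);
  adj_natl : forall X X' Y (g : mor (F X) Y) (f : mor X' X),
    adj (g \oc functor_map F f) = adj g \oc f;
  adj_natr : forall X Y Y' (h : mor Y Y') (g : mor (F X) Y),
    adj (h \oc g) = functor_map G h \oc adj g
}.

Section LinMap.
Variables (k : fieldType) (U V : lmodType k).

Definition linmap : Type := {linear U -> V}.

HB.instance Definition _ := gen_eqMixin linmap.
HB.instance Definition _ := gen_choiceMixin linmap.

Lemma linmapP (f g : linmap) : (forall x, f x = g x) -> f = g.
Proof.
case: f g => [f [[f1] [f2]]] [g [[g1] [g2]]] /= /funext fg.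
move: f1 f2 g1 g2; rewrite fg => f1 f2 g1 g2.
by rewrite (Prop_irrelevance f1 g1) (Prop_irrelevance f2 g2).
Qed.

End LinMap.

Section LinMapModule.
Variables (k : fieldType) (U V : lmodType k).
Implicit Types f g h : linmap U V.

Let lin0 : linmap U V := \0.
Let linN f : linmap U V := \- f.
Let linD f g : linmap U V := f \+ g.
Let linZ (a : k) f : linmap U V := a \*: f.

Fact linmap_addA : associative linD.
Proof. by move=> f g h; apply: linmapP => x /=; rewrite addrA. Qed.
Fact linmap_addC : commutative linD.
Proof. by move=> f g; apply: linmapP => x /=; rewrite addrC. Qed.
Fact linmap_add0 : left_id lin0 linD.
Proof. by move=> f; apply: linmapP => x /=; rewrite add0r. Qed.
Fact linmap_addN : left_inverse lin0 linN linD.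
Proof. by move=> f; apply: linmapP => x /=; rewrite addNr. Qed.

HB.instance Definition _ := GRing.isZmodule.Build (linmap U V)
  linmap_addA linmap_addC linmap_add0 linmap_addN.

Fact linmap_scaleA a b f : linZ a (linZ b f) = linZ (a * b) f.
Proof. by apply: linmapP => x /=; rewrite scalerA. Qed.
Fact linmap_scale1 : left_id 1 linZ.
Proof. by move=> f; apply: linmapP => x /=; rewrite scale1r. Qed.
Fact linmap_scaleDr : right_distributive linZ +%R.
Proof. by move=> a f g; apply: linmapP => x /=; rewrite scalerDr. Qed.
Fact linmap_scaleDl f : {morph linZ^~ f : a b / a + b}.
Proof. by move=> a b; apply: linmapP => x /=; rewrite scalerDl. Qed.

HB.instance Definition _ := GRing.Zmodule_isLmodule.Build k (linmap U V)
  linmap_scaleA linmap_scale1 linmap_scaleDr linmap_scaleDl.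

End LinMapModule.

Definition linmap_of (k : fieldType) (U V : lmodType k) (f : U -> V)
    (f_lin : linear f) : linmap U V :=
  HB.pack_for {linear U -> V} f (GRing.isLinear.Build _ _ _ _ f f_lin).

Section Mod.
Variable k : fieldType.

Definition linmap_id (U : lmodType k) : linmap U U := idfun.
Definition linmap_comp (U V W : lmodType k) (g : linmap V W) (f : linmap U V)
  : linmap U W := g \o f.

Program Definition Mod : klincat k :=
  @KLinCat k (lmodType k) (fun U V => linmap U V : lmodType k)
    linmap_id linmap_comp _ _ _ _ _.
Solve All Obligations with
  by move=> *; apply: linmapP => x //=; rewrite linearP.

End Mod.

Notation modhom k U V := (@mor k (Mod k) U V) (only parsing).

Section HomFunctor.
Variables (k : fieldType) (S : klincat k).

Fact postcomp_linear (M X Y : S) (g : mor X Y) :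
  linear (fun f : mor M X => g \oc f).
Proof. by move=> a f f'; rewrite comp_linr. Qed.

Fact precomp_linear (M N X : S) (phi : mor M N) :
  linear (fun f : mor N X => f \oc phi).
Proof. by move=> a f f'; rewrite comp_linl. Qed.

Definition postcomp (M X Y : S) (g : mor X Y) :
  modhom k (mor M X) (mor M Y) := linmap_of (postcomp_linear g).

Definition precomp (M N X : S) (phi : mor M N) :
  modhom k (mor N X) (mor M X) := linmap_of (precomp_linear phi).

Program Definition hom_functor (M : S) : functor S (Mod k) :=
  @Functor k S (Mod k) (fun X => mor M X) (postcomp M) _ _.
Next Obligation. by apply: linmapP => f /=; rewrite comp1m. Qed.
Next Obligation.
by apply: linmapP => h /=; rewrite compmA.
Qed.

End HomFunctor.

Fact scal_linear1 (k : fieldType) (V : lmodType k) (v : V) :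
  linear (fun a : k^o => a *: v).
Proof. by move=> a b c; rewrite scalerDl scalerA. Qed.

Fact scal_linear (k : fieldType) (V : lmodType k) :
  linear (fun v : V => linmap_of (scal_linear1 v)).
Proof.
move=> a v w; apply: linmapP => b /=.
by rewrite scalerDr !scalerA mulrC.
Qed.

(* v |-> (a |-> a *: v) *)
Definition scal (k : fieldType) (V : lmodType k) :
    modhom k V (modhom k k^o V) :=
  linmap_of (@scal_linear k V).

(* For every object M, a left adjoint M (x) - : Mod k -> S of S(M, -).  Such  *)
(* a choice exists in every k-linear Grothendieck category and is unique up   *)
(* to unique isomorphism. For S = Mod k it is the tensor product over k:      *)
(* Hom(U (x) V, W) ~ Hom(V, Hom(U, W)).                                       *)
Record tensoring (k : fieldType) (S : klincat k) := Tensoring {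
  tens :> forall M : S, functor (Mod k) S;
  tens_adj : forall M : S, adjunction (tens M) (hom_functor M)
}.

Section Tensoring.
Variables (k : fieldType) (S : klincat k) (T : tensoring S).
Implicit Types (M N : S) (V W : lmodType k).

Definition tcurry M V N (g : mor (T M V) N) : linmap V (mor M N) :=
  adj (tens_adj T M) g.
Definition tuncurry M V N (f : linmap V (mor M N)) : mor (T M V) N :=
  adjV (tens_adj T M) f.

Lemma tcurryK M V N : cancel (@tcurry M V N) (@tuncurry M V N).
Proof. exact: adjK. Qed.
Lemma tuncurryK M V N : cancel (@tuncurry M V N) (@tcurry M V N).
Proof. by move=> f; exact: (adjVK (tens_adj T M) f). Qed.

(* the unit of the adjunction, V -> S(M, M (x) V) *)
Definition tens_unit M V : linmap V (mor M (T M V)) := tcurry (idmor (T M V)).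

Lemma tcurryE M V N (g : mor (T M V) N) v : tcurry g v = g \oc tens_unit M V v.
Proof. by rewrite /tcurry -{1}[g]compm1 adj_natr. Qed.

Lemma tcurry_linear M V N : linear (@tcurry M V N).
Proof.
move=> a f g; apply: linmapP => v.
by rewrite (tcurryE (a *: f + g) v) comp_linl -(tcurryE f v) -(tcurryE g v).
Qed.

Lemma tuncurry_linear M V N : linear (@tuncurry M V N).
Proof.
move=> a f g; apply: (can_inj (@tcurryK M V N)).
by rewrite tcurry_linear !tuncurryK.
Qed.

Definition tcurryL M V N :
    modhom k (mor (T M V) N) (modhom k V (mor M N)) :=
  linmap_of (@tcurry_linear M V N).
Definition tuncurryL M V N :
    modhom k (modhom k V (mor M N)) (mor (T M V) N) :=
  linmap_of (@tuncurry_linear M V N).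

(* phi (x) V, making (x) a bifunctor S x Mod k -> S *)
Definition tensl M N (phi : mor M N) V : mor (T M V) (T N V) :=
  tuncurry (precomp (T N V) phi \oc (tens_unit N V : modhom k _ _)).

(* M (x) f *)
Definition tensr M V W (f : modhom k V W) : mor (T M V) (T M W) :=
  functor_map (T M) f.

(* M ~ M (x) k *)
Definition runit M : mor M (T M k^o) := tens_unit M k^o 1.
Definition runitV M : mor (T M k^o) M := tuncurry (scal (mor M M) (idmor M)).

Lemma tens_ext M V N (f g : mor (T M V) N) :
  (forall v, f \oc tens_unit M V v = g \oc tens_unit M V v) -> f = g.
Proof.
move=> fg; apply: (can_inj (@tcurryK M V N)); apply: linmapP => v.
by rewrite (tcurryE f) (tcurryE g).
Qed.

Lemma tuncurryE M V N (f : linmap V (mor M N)) v :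
  tuncurry f \oc tens_unit M V v = f v.
Proof. by rewrite -tcurryE tuncurryK. Qed.

Lemma tensr_unit M V W (f : modhom k V W) v :
  tensr M f \oc tens_unit M V v = tens_unit M W (f v).
Proof.
rewrite -tcurryE /tcurry /tensr -[functor_map _ f]comp1m.
by rewrite (adj_natl (tens_adj T M)).
Qed.

Lemma tensl_unit M N (phi : mor M N) V v :
  tensl phi V \oc tens_unit M V v = tens_unit N V v \oc phi.
Proof. by rewrite /tensl tuncurryE. Qed.

Lemma tensl_linear M N V : linear (fun phi : mor M N => tensl phi V).
Proof.
move=> a f g; apply: tens_ext => v.
by rewrite comp_linl !tensl_unit comp_linr.
Qed.

Lemma tensl1 M V : tensl (idmor M) V = idmor (T M V).
Proof. by apply: tens_ext => v; rewrite tensl_unit compm1 comp1m. Qed.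

Lemma tenslM M N P (psi : mor N P) (phi : mor M N) V :
  tensl (psi \oc phi) V = tensl psi V \oc tensl phi V.
Proof.
by apply: tens_ext => v; rewrite -compmA !tensl_unit !compmA tensl_unit.
Qed.

Lemma runitV_unit M a : runitV M \oc tens_unit M k^o a = a *: idmor M.
Proof. by rewrite /runitV tuncurryE. Qed.

End Tensoring.

(* Associativity (M (x) V) (x) W ~ M (x) (V (x) W), and V ~ k (x) V *)
Section Coherence.
Variables (k : fieldType) (TV : tensoring (Mod k)).
Variables (S : klincat k) (T : tensoring S).
Implicit Types (M : S) (V W : Mod k).

(* (m (x) v) (x) w |-> m (x) (v (x) w) *)
Definition assoc M V W : mor (T (T M V) W) (T M (TV V W)) :=
  tuncurry T (tuncurryL T M V (T M (TV V W))
    \oc postcomp V (tens_unit T M (TV V W) : mor (TV V W) _)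
    \oc (tens_unit TV V W : modhom k _ _)).

(* m (x) (v (x) w) |-> (m (x) v) (x) w *)
Definition assocV M V W : mor (T M (TV V W)) (T (T M V) W) :=
  tuncurry T (tuncurry TV (tcurryL T M V (T (T M V) W)
    \oc (tens_unit T (T M V) W : modhom k _ _))).

Fact eval1_linear (V : lmodType k) : linear (fun f : linmap k^o V => f 1).
Proof. by []. Qed.

(* v |-> 1 (x) v *)
Definition lunit V : mor V (TV k^o V) :=
  (linmap_of (@eval1_linear (TV k^o V)) : modhom k _ _)
    \oc (tens_unit TV k^o V : modhom k _ _).
Definition lunitV V : mor (TV k^o V) V := tuncurry TV (scal V).

Lemma assoc_unit M V W v w :
  assoc M V W \oc (tens_unit T (T M V) W w \oc tens_unit T M V v)
  = tens_unit T M (TV V W) (tens_unit TV V W w v).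
Proof.
rewrite compmA /assoc tuncurryE /=.
by rewrite tuncurryE.
Qed.

Lemma assocV_unit M V W v w :
  assocV M V W \oc tens_unit T M (TV V W) (tens_unit TV V W w v)
  = tens_unit T (T M V) W w \oc tens_unit T M V v.
Proof.
rewrite /assocV tuncurryE; set g := (g in tuncurry TV g).
rewrite -tcurryE.
exact: (congr1 (fun f => GRing.Linear.sort f v) (tuncurryE TV g w)).
Qed.

Lemma lunit_unit V (v : V) : lunit V v = tens_unit TV k^o V v 1.
Proof. by []. Qed.

Lemma lunitV_unit V (v : V) (a : k) :
  lunitV V (tens_unit TV k^o V v a) = a *: v.
Proof.
exact: (congr1 (fun f : linmap k^o V => f a) (tuncurryE TV (scal V) v)).
Qed.

End Coherence.

Section Entwining.
Variables (k : fieldType) (TV : tensoring (Mod k)).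

Record algebra := Algebra {
  alg :> lmodType k;
  alg_mul : modhom k (TV alg alg) alg;
  alg_one : modhom k k^o alg;
  alg_mulA : alg_mul \oc tensl TV alg_mul alg =
    alg_mul \oc tensr TV alg alg_mul \oc assoc TV TV alg alg alg;
  alg_mul1l :
    alg_mul \oc tensl TV alg_one alg \oc lunit TV alg
      = idmor (alg : Mod k);
  alg_mul1r :
    alg_mul \oc tensr TV alg alg_one \oc runit TV alg
      = idmor (alg : Mod k)
}.

Record coalgebra := Coalgebra {
  coalg :> lmodType k;
  coalg_comul : modhom k coalg (TV coalg coalg);
  coalg_counit : modhom k coalg k^o;
  coalg_comulA : tensr TV coalg coalg_comul \oc coalg_comul =
    assoc TV TV coalg coalg coalg
      \oc tensl TV coalg_comul coalg \oc coalg_comul;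
  coalg_counitl :
    lunitV TV coalg \oc tensl TV coalg_counit coalg \oc coalg_comul
      = idmor (coalg : Mod k);
  coalg_counitr :
    runitV TV coalg \oc tensr TV coalg coalg_counit \oc coalg_comul
      = idmor (coalg : Mod k)
}.

Record is_entwining (A : algebra) (C : coalgebra) (psi : mor (TV C A) (TV A C))
    : Prop := IsEntwining {
  entw_mul : psi \oc tensr TV C (alg_mul A) \oc assoc TV TV C A A =
    tensl TV (alg_mul A) C \oc assocV TV TV A A C \oc tensr TV A psi
      \oc assoc TV TV A C A \oc tensl TV psi A;
  entw_one : psi \oc tensr TV C (alg_one A) \oc runit TV C =
    tensl TV (alg_one A) C \oc lunit TV C;
  entw_comul : tensr TV A (coalg_comul C) \oc psi =
    assoc TV TV A C C \oc tensl TV psi C \oc assocV TV TV C A C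
      \oc tensr TV C psi \oc assoc TV TV C C A
      \oc tensl TV (coalg_comul C) A;
  entw_counit : runitV TV A \oc tensr TV A (coalg_counit C) \oc psi =
    lunitV TV A \oc tensl TV (coalg_counit C) A
}.

End Entwining.

Section EntwinedComodules.
Variables (k : fieldType) (TV : tensoring (Mod k)).
Variables (S : klincat k) (T : tensoring S).
Variables (A : algebra TV) (C : coalgebra TV) (psi : mor (TV C A) (TV A C)).

Record is_comodule_object (M : S) (d : mor M (T M C)) : Prop :=
    IsComoduleObject {
  comod_comulA : assocV TV T M C C \oc tensr T M (coalg_comul C) \oc d =
    tensl T d C \oc d;
  comod_counit : runitV T M \oc tensr T M (coalg_counit C) \oc d = idmor M
}.

Record is_module_object (M : S) (m : mor (T M A) M) : Prop :=
    IsModuleObject {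
  mod_mulA : m \oc tensr T M (alg_mul A) \oc assoc TV T M A A =
    m \oc tensl T m A;
  mod_one : m \oc tensr T M (alg_one A) \oc runit T M = idmor M
}.

Record entwined_comodule := EntwinedComodule {
  ec_obj :> S;
  ec_coact : mor ec_obj (T ec_obj C);
  ec_act : mor (T ec_obj A) ec_obj;
  ec_comodule : is_comodule_object ec_coact;
  ec_module : is_module_object ec_act;
  ec_compat : ec_coact \oc ec_act =
    tensl T ec_act C \oc assocV TV T ec_obj A C \oc tensr T ec_obj psi
      \oc assoc TV T ec_obj C A \oc tensl T ec_coact A
}.

Implicit Types M N P : entwined_comodule.

Definition colinear M N (f : mor (M : S) N) : Prop :=
  ec_coact N \oc f = tensl T f C \oc ec_coact M.

Definition alinear M N (f : mor (M : S) N) : Prop :=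
  f \oc ec_act M = ec_act N \oc tensl T f A.

Definition entwined_pred M N : pred (mor (M : S) N) :=
  fun f => `[< colinear f /\ alinear f >].

Record entwined_hom M N := EntwinedHom {
  ehom :> mor (M : S) N;
  ehomP : entwined_pred ehom
}.

HB.instance Definition _ M N := [isSub for @ehom M N].
HB.instance Definition _ M N := [Choice of entwined_hom M N by <:].

Fact entwined_pred_submod M N : subsemimod_closed (@entwined_pred M N).
Proof.
suff H a f g : entwined_pred f -> entwined_pred g ->
    @entwined_pred M N (a *: f + g).
  have H0 : @entwined_pred M N 0.
    apply/asboolP; split; rewrite /colinear /alinear.
      by rewrite -(subrr 0) -scaleN1r addrC comp_linr tensl_linear comp_linl
        scaleN1r addNr scaleN1r addNr.
    by rewrite -(subrr 0) -scaleN1r addrC comp_linl tensl_linear comp_linr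
        scaleN1r addNr scaleN1r addNr.
  split; first split=> // f g fP gP.
    by rewrite -[f]scale1r; apply: H.
  by move=> a f fP; rewrite -[a *: f]addr0; apply: H.
move=> /asboolP[fC fA] /asboolP[gC gA]; apply/asboolP; split.
  by rewrite /colinear comp_linr tensl_linear comp_linl fC gC.
by rewrite /alinear comp_linl tensl_linear comp_linr fA gA.
Qed.

HB.instance Definition _ M N :=
  GRing.SubChoice_isSubLmodule.Build k (mor (M : S) N) (@entwined_pred M N)
    (entwined_hom M N) (@entwined_pred_submod M N).

Fact entwined_id_subproof M : @entwined_pred M M (idmor (M : S)).
Proof.
by apply/asboolP; split; rewrite /colinear /alinear tensl1 comp1m compm1.
Qed.

Definition entwined_id M : entwined_hom M M :=
  EntwinedHom (entwined_id_subproof M).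

Fact entwined_comp_subproof M N P (g : entwined_hom N P)
  (f : entwined_hom M N) : @entwined_pred M P (ehom g \oc ehom f).
Proof.
have /asboolP[gC gA] := ehomP g; have /asboolP[fC fA] := ehomP f.
apply/asboolP; split; rewrite /colinear /alinear tenslM.
  by rewrite compmA gC -!compmA fC.
by rewrite -compmA fA !compmA gA.
Qed.

Definition entwined_comp M N P (g : entwined_hom N P) (f : entwined_hom M N) :
    entwined_hom M P :=
  EntwinedHom (entwined_comp_subproof g f).

Program Definition entwined_category : klincat k :=
  @KLinCat k entwined_comodule (fun M N => entwined_hom M N : lmodType k)
    entwined_id entwined_comp _ _ _ _ _.
Next Obligation. by apply: val_inj; rewrite /= comp1m. Qed.
Next Obligation. by apply: val_inj; rewrite /= compm1. Qed.
Next Obligation. by apply: val_inj; rewrite /= compmA. Qed.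
Next Obligation. by apply: val_inj; exact: comp_linl.
Qed.
Next Obligation. by apply: val_inj; exact: comp_linr.
Qed.

End EntwinedComodules.

(* Main.v *)
Require Import Defs.
From mathcomp Require Import all_boot all_algebra.
From mathcomp Require Import boolp.
From mathcomp Require classical_sets.
Local Open Scope ring_scope.

Set Implicit Arguments.
Unset Strict Implicit.
Unset Printing Implicit Defensive.

Import GRing.Theory.
Local Open Scope cat_scope.

(* Since [V] is the filtered colimit of the free modules of finite rank over  *)
(* it, the axiom AB5 reduces the exactness of [- (x) V] to that of finite     *)
(* powers. Hence the forgetful functor from entwined comodule objects to [S]  *)
(* creates kernels and colimits, and all the axioms but the existence of a    *)
(* generator descend from [S].                                                *)
(*   For the generator, let [G] generate [S] and let [x : G -> M] be a map to *)
(* an entwined comodule object. The dual [C'] acts on [M] by                  *)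
(* [(M (x) phi) d], and the image of the induced map [(G (x) C') (x) A -> M]  *)
(* is an entwined subobject through which [x] factors: it is stable under the *)
(* coaction because the maps [X (x) phi : X (x) C -> X] are jointly monic, by *)
(* AB5 and the existence of enough functionals on [C]. So every [M] is        *)
(* covered by entwined comodule objects whose underlying objects are          *)
(* quotients of [(G (x) C') (x) A]; these form a small set up to              *)
(* isomorphism, and their coproduct is a generator.                           *)

(** * Linear and abelian categories *)

(** The structure maps of an entwined comodule object are maps of [S], and both sides of every axiom
    are natural in maps compatible with them. Hence the axioms pass to the target of a jointly epic
    family ([is_entwined_jointly_epi]) and to a subobject ([is_entwined_mono]). The first rests on
    tensoring preserving joint epis, the second on [- (x) C] preserving monos. Right exactness of
    [- (x) V] is formal ([tensl_cokernel]); left exactness ([tensl_kernel]) comes from AB5 through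
    [free_colimit]. So kernels, cokernels and colimits are computed in [S] ([forget_kernelE],
    [forget_cokernelE], [forget_colimit]), whence abelianness, cocompleteness and AB5. For the
    generator the point is a bound on size. A map from a generator [G] of [S] into an entwined
    object factors through an entwined subobject that is a quotient of one fixed object
    ([orbit_gen], [orbit_image_entwined]), and the quotients of that object form a small set
    ([quotients_small]). Stability of this subobject under the coaction follows from stability under
    the dual of [C], because contractions with functionals are jointly monic ([ev_jointly_mono]). *)

Program Definition discrete_cat (I : Type@{GRing.Lmodule.axioms_.u0}) :=
  @SmallCat I (fun i j => i = j) (fun i => erefl) (fun i j l b a => etrans a b)
    _ _ _.
Solve All Obligations with by move=> *; exact: Prop_irrelevance.

Section LinearCategory.
Variables (k : fieldType) (S : klincat k).
Implicit Types X Y Z W : S.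

Lemma comp0m X Y Z (f : mor X Y) : (0 : mor Y Z) \oc f = 0.
Proof. exact: (raddf0 (precomp Z f)). Qed.

Lemma compm0 X Y Z (g : mor Y Z) : g \oc (0 : mor X Y) = 0.
Proof. exact: (raddf0 (postcomp X g)). Qed.

Lemma compBm X Y Z (g g' : mor Y Z) (f : mor X Y) :
  (g - g') \oc f = g \oc f - g' \oc f.
Proof. exact: (raddfB (precomp Z f)). Qed.

Lemma compmB X Y Z (g : mor Y Z) (f f' : mor X Y) :
  g \oc (f - f') = g \oc f - g \oc f'.
Proof. exact: (raddfB (postcomp X g)). Qed.

Lemma compDm X Y Z (g g' : mor Y Z) (f : mor X Y) :
  (g + g') \oc f = g \oc f + g' \oc f.
Proof. exact: (raddfD (precomp Z f)). Qed.


Lemma compZm X Y Z (a : k) (g : mor Y Z) (f : mor X Y) :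
  (a *: g) \oc f = a *: (g \oc f).
Proof. exact: (linearZZ (precomp Z f)). Qed.

Lemma compmZ X Y Z (a : k) (g : mor Y Z) (f : mor X Y) :
  g \oc (a *: f) = a *: (g \oc f).
Proof. exact: (linearZZ (postcomp X g)). Qed.

Lemma compm_sumr X Y Z (I : Type) (r : seq I) (P : pred I) (g : mor Y Z)
    (f : I -> mor X Y) :
  g \oc (\sum_(i <- r | P i) f i) = \sum_(i <- r | P i) g \oc f i.
Proof. exact: (raddf_sum (postcomp X g)). Qed.

Lemma compm_suml X Y Z (I : Type) (r : seq I) (P : pred I)
    (g : I -> mor Y Z) (f : mor X Y) :
  (\sum_(i <- r | P i) g i) \oc f = \sum_(i <- r | P i) g i \oc f.
Proof. exact: (raddf_sum (precomp Z f)). Qed.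

Lemma mono0P X Y (f : mor X Y) :
  mono f <-> forall Z (g : mor Z X), f \oc g = 0 -> g = 0.
Proof.
split=> [mf Z g fg|f0 Z g h fgh]; first by apply: mf; rewrite fg compm0.
by apply/eqP; rewrite -subr_eq0; apply/eqP/f0; rewrite compmB fgh subrr.
Qed.

Lemma epi0P X Y (f : mor X Y) :
  epi f <-> forall Z (g : mor Y Z), g \oc f = 0 -> g = 0.
Proof.
split=> [ef Z g fg|f0 Z g h fgh]; first by apply: ef; rewrite fg comp0m.
by apply/eqP; rewrite -subr_eq0; apply/eqP/f0; rewrite compBm fgh subrr.
Qed.

Lemma mono_comp X Y Z (g : mor Y Z) (f : mor X Y) :
  mono g -> mono f -> mono (g \oc f).
Proof. by move=> mg mf W u v; rewrite -!compmA => /mg/mf. Qed.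


Lemma split_mono X Y (f : mor X Y) (r : mor Y X) : r \oc f = idmor X -> mono f.
Proof.
by move=> rf Z g h fgh; rewrite -[g]comp1m -[h]comp1m -rf -!compmA fgh.
Qed.

Lemma split_epi X Y (f : mor X Y) (r : mor Y X) : f \oc r = idmor Y -> epi f.
Proof.
by move=> rf Z g h fgh; rewrite -[g]compm1 -[h]compm1 -rf !compmA fgh.
Qed.

Lemma kernelP K X Y (i : mor K X) (f : mor X Y) :
  is_kernel i f <-> [/\ f \oc i = 0, mono i
    & forall Z (g : mor Z X), f \oc g = 0 -> exists h, i \oc h = g].
Proof.
split=> [[fi U]|[fi mi E]]; split=> //.
- apply/mono0P => Z g ig; have [|h [_ Uh]] := U Z 0; first by rewrite compm0.
  by rewrite -(Uh g ig); apply: Uh; rewrite compm0.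
- by move=> Z g /U[h [ih _]]; exists h.
- by move=> Z g /E[h ih]; exists h; split=> // h'; rewrite -ih => /mi.
Qed.

Lemma cokernelP X Y Q (p : mor Y Q) (f : mor X Y) :
  is_cokernel p f <-> [/\ p \oc f = 0, epi p
    & forall Z (g : mor Y Z), g \oc f = 0 -> exists h, h \oc p = g].
Proof.
split=> [[fi U]|[fi mi E]]; split=> //.
- apply/epi0P => Z g ig; have [|h [_ Uh]] := U Z 0; first by rewrite comp0m.
  by rewrite -(Uh g ig); apply: Uh; rewrite comp0m.
- by move=> Z g /U[h [ih _]]; exists h.
- by move=> Z g /E[h ih]; exists h; split=> // h'; rewrite -ih => /mi.
Qed.

Lemma kernel_mono K X Y (i : mor K X) (f : mor X Y) : is_kernel i f -> mono i.
Proof. by case/kernelP. Qed.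

Lemma cokernel_epi X Y Q (p : mor Y Q) (f : mor X Y) : is_cokernel p f -> epi p.
Proof. by case/cokernelP. Qed.

Lemma kernel_of_mono_comp K X Y Z (i : mor K X) (f : mor X Y) (j : mor Y Z) :
  mono j -> is_kernel i (j \oc f) <-> is_kernel i f.
Proof.
move=> mj; split=> /kernelP[fi mi U]; apply/kernelP; split=> //.
- by apply: mj; rewrite compmA fi compm0.
- by move=> W g fg; apply: U; rewrite -compmA fg compm0.
- by rewrite -compmA fi compm0.
- by move=> W g; rewrite -compmA => fg; apply: U; apply: mj; rewrite fg compm0.
Qed.

Lemma kernel_retract K L X Y (i : mor K X) (f : mor X Y) (j : mor L X)
    (r : mor L K) (s : mor K L) :
  is_kernel i f -> j = i \oc r -> i = j \oc s -> s \oc r = idmor L ->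
  is_kernel j f.
Proof.
move=> /kernelP[fi mi U] ej ei sr; apply/kernelP; split.
- by rewrite ej compmA fi comp0m.
- by rewrite ej; apply: mono_comp (split_mono sr).
- by move=> Z g /U[h ih]; exists (s \oc h); rewrite compmA -ei.
Qed.

Lemma cokernel_retract X Y Q R (p : mor Y Q) (f : mor X Y) (q : mor Y R)
    (r : mor Q R) (s : mor R Q) :
  is_cokernel p f -> q = r \oc p -> p = s \oc q -> r \oc s = idmor R ->
  is_cokernel q f.
Proof.
move=> /cokernelP[pf ep U] eq_q eq_p rs; apply/cokernelP; split.
- by rewrite eq_q -compmA pf compm0.
- move=> Z u v; rewrite eq_q !compmA => /ep uv.
  exact: (split_epi rs).
- by move=> Z g /U[h hp]; exists (h \oc s); rewrite -compmA -eq_p.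
Qed.

Section Colimits.
Variables (J : smallcat).

Lemma colimit_ext (D : diagram S J) L (c : forall j, mor (D j) L) X
    (f g : mor L X) :
  is_colimit c -> (forall j, f \oc c j = g \oc c j) -> f = g.
Proof.
move=> [cC U] fg; have [|h [_ Uh]] := U X (fun j => g \oc c j).
  by move=> i j a; rewrite -compmA cC.
by rewrite -(Uh f fg); apply: Uh.
Qed.

Lemma colimit_fact (D : diagram S J) L (c : forall j, mor (D j) L) X
    (d : forall j, mor (D j) X) :
  is_colimit c -> is_cocone d -> exists h, forall j, h \oc c j = d j.
Proof. by move=> [_ U] /U[h [ch _]]; exists h. Qed.

Lemma colimitI (D : diagram S J) L (c : forall j, mor (D j) L) :
  is_cocone c ->
  (forall X (f g : mor L X), (forall j, f \oc c j = g \oc c j) -> f = g) ->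
  (forall X (d : forall j, mor (D j) X), is_cocone d ->
    exists h, forall j, h \oc c j = d j) ->
  is_colimit c.
Proof.
move=> cC cE cF; split=> // X d /cF[h hc]; exists h; split=> // h' h'c.
by apply: cE => j; rewrite hc h'c.
Qed.

Lemma colimit_retract (D : diagram S J) L L' (c : forall j, mor (D j) L)
    (c' : forall j, mor (D j) L') (r : mor L L') (s : mor L' L) :
  is_colimit c ->
  (forall j, c' j = r \oc c j) -> (forall j, c j = s \oc c' j) ->
  r \oc s = idmor L' -> is_colimit c'.
Proof.
move=> cL ec' ec rs; apply: colimitI.
- by move=> i j a; rewrite !ec' -compmA (proj1 cL).
- move=> X f g fg; apply: (split_epi rs); apply: (colimit_ext cL) => j.
  by rewrite -!compmA -ec'.
- move=> X d /(colimit_fact cL)[h hc]; exists (h \oc s) => j.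
  by rewrite -compmA -ec.
Qed.

End Colimits.

Lemma cocomplete_coproduct (I : Type@{GRing.Lmodule.axioms_.u0}) (F : I -> S) :
  is_cocomplete S ->
  exists L (c : forall i, mor (F i) L),
    (forall X (f g : mor L X), (forall i, f \oc c i = g \oc c i) -> f = g) /\
    forall X (d : forall i, mor (F i) X), exists h, forall i, h \oc c i = d i.
Proof.
pose J := discrete_cat I; pose Jhom : J -> J -> _ := @shom J.
pose m i j (a : Jhom i j) : mor (F i) (F j) :=
  match a in _ = j return mor (F i) (F j) with erefl => idmor (F i) end.
have mM i j l (b : Jhom j l) (a : Jhom i j) :
    m i l (etrans a b) = m j l b \oc m i j a.
  by case: j / a b => b; case: l / b; rewrite /= comp1m.
pose D := @Diagram k S J F m (fun=> erefl) mM.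
move=> /(_ J D)[L [c cL]]; exists L, c; split=> [X f g|X d].
  exact: (colimit_ext cL).
apply: (colimit_fact cL) => i j a.
by case: j / a; rewrite compm1.
Qed.

(** The empty coproduct has no legs, so its identity equals zero vacuously. *)
Lemma cocomplete_zero_object :
  is_cocomplete S -> exists Z : S, is_zero_object Z.
Proof.
move=> /(cocomplete_coproduct (fun x : void => match x with end))[Z [c [cE _]]].
have id0 : idmor Z = 0 by apply: cE; case.
exists Z => X; split=> f; first by rewrite -[f]comp1m id0 comp0m.
by rewrite -[f]compm1 id0 compm0.
Qed.

Lemma cocomplete_biproduct X Y : is_cocomplete S -> exists B (i1 : mor X B)
  (i2 : mor Y B) (p1 : mor B X) (p2 : mor B Y), is_biproduct i1 i2 p1 p2.
Proof.
pose F b := if b then X else Y.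
move=> /(cocomplete_coproduct F)[B [c [cE cF]]].
pose d Z (f : mor X Z) (g : mor Y Z) b : mor (F b) Z :=
  match b return mor (F b) Z with true => f | false => g end.
have [p1 p1E] := cF X (d X (idmor X) 0).
have [p2 p2E] := cF Y (d Y 0 (idmor Y)).
exists B, (c true), (c false), p1, p2; split.
- exact: (p1E true).
- exact: (p2E false).
- exact: (p1E false).
- exact: (p2E true).
apply: cE => b; rewrite compDm comp1m -!compmA p1E p2E.
by case: b; rewrite /= compm0 compm1 ?addr0 ?add0r.
Qed.

End LinearCategory.

(** * Normality and image factorizations in an abelian category *)

Section AbelianCategory.
Variables (k : fieldType) (S : klincat k).
Hypothesis abS : is_abelian S.
Implicit Types X Y Z W : S.

Lemma mono_kernel_coker X Y Q (f : mor X Y) (p : mor Y Q) :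
  mono f -> is_cokernel p f -> is_kernel f p.
Proof.
move=> /(mono_normal abS)[Z [g /kernelP[gf mf U]]] /cokernelP[pf ep V].
apply/kernelP; split=> // W h ph; apply: U.
by have [u <-] := V _ _ gf; rewrite -compmA ph compm0.
Qed.

Lemma epi_coker_kernel K X Y (f : mor X Y) (i : mor K X) :
  epi f -> is_kernel i f -> is_cokernel f i.
Proof.
move=> /(epi_normal abS)[Z [g /cokernelP[gf ef U]]] /kernelP[fi mi V].
apply/cokernelP; split=> // W h ph; apply: U.
by have [u <-] := V _ _ gf; rewrite compmA ph comp0m.
Qed.

(** The image is the kernel of the cokernel; only the epimorphy of the corestriction [e] needs an
    argument. *)
Lemma image_factorization X Y (f : mor X Y) :
  exists I (j : mor I Y) (e : mor X I), [/\ mono j, epi e & f = j \oc e].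
Proof.
have [Q [p kp]] := has_cokernels abS f.
have [I [j /kernelP[pj mj Uj]]] := has_kernels abS p.
have /cokernelP[pf ep Up] := kp.
have [e je] := Uj _ _ pf; exists I, j, e; split=> //.
apply/epi0P => W g ge.
have [K [i ki]] := has_kernels abS g.
have /kernelP[gi mi Ui] := ki.
have [e' ie'] := Ui _ _ ge.
(* The mono [j \oc i] is a kernel of some [h]. As [h] kills [f], it factors through the cokernel [p]
   and so kills [j]; hence [j] factors through [j \oc i], which makes [i] split epi and forces
   [g = 0]. *)
have [H [h /kernelP[hji mji Uji]]] := mono_normal abS (mono_comp mj mi).
have /Up[h' h'p] : h \oc f = 0.
  by rewrite -je -ie' !compmA -(compmA h) hji comp0m.
have [t jit] : exists t, j \oc i \oc t = j.
  by apply: Uji; rewrite -h'p -compmA pj compm0.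
have it : i \oc t = idmor I by apply: mj; rewrite compmA jit compm1.
by rewrite -[g]compm1 -it compmA gi comp0m.
Qed.

End AbelianCategory.

(** * Naturality and right exactness of the tensor product *)

(* Canonical module structures are not inferred at the type [obj (Mod k)],    *)
(* hence the casts here and in [rV] below.                                    *)
Notation scalars k := (k^o : lmodType k) (only parsing).

Section Tensor.
Variables (k : fieldType) (S : klincat k) (T : tensoring S).
Implicit Types (M N L X Y Z : S) (U V W : lmodType k).

Definition jointly_epi (I : Type) (M : I -> S) L (c : forall i, mor (M i) L) :=
  forall Z (f g : mor L Z), (forall i, f \oc c i = g \oc c i) -> f = g.

Lemma tensr1 M V : tensr T M (idmor (V : Mod k)) = idmor (T M V).
Proof. exact: functor_map1. Qed.

Lemma tensrM M U V W (g : modhom k V W) (f : modhom k U V) :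
  tensr T M (g \oc f) = tensr T M g \oc tensr T M f.
Proof. exact: functor_mapM. Qed.

Lemma tensl_tensr M N V W (phi : mor M N) (f : modhom k V W) :
  tensl T phi W \oc tensr T M f = tensr T N f \oc tensl T phi V.
Proof.
apply: tens_ext => v.
by rewrite -!compmA tensr_unit !tensl_unit compmA tensr_unit.
Qed.

Lemma runit_natural M N (phi : mor M N) :
  tensl T phi k^o \oc runit T M = runit T N \oc phi.
Proof. exact: tensl_unit. Qed.

Lemma runitV_natural M N (phi : mor M N) :
  runitV T N \oc tensl T phi k^o = phi \oc runitV T M.
Proof.
apply: tens_ext => a.
rewrite -compmA tensl_unit compmA -[in RHS]compmA !runitV_unit.
by rewrite compZm compmZ comp1m compm1.
Qed.

Lemma tensl0 M N V : tensl T (0 : mor M N) V = 0.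
Proof. by apply: tens_ext => v; rewrite tensl_unit compm0 comp0m. Qed.

Lemma tensl_epi M N V (p : mor M N) : epi p -> epi (tensl T p V).
Proof.
move=> ep Z f g fg; apply: tens_ext => v; apply: ep.
by rewrite -!compmA -tensl_unit !compmA fg.
Qed.

Lemma tensl_jointly_epi (I : Type) (M : I -> S) L (c : forall i, mor (M i) L)
    V :
  jointly_epi c -> jointly_epi (fun i => tensl T (c i) V).
Proof.
move=> cE Z f g fg; apply: tens_ext => v; apply: cE => i.
by rewrite -!compmA -tensl_unit !compmA fg.
Qed.


(** Maps out of a tensor product can thus be assembled from maps chosen vector by vector through a
    universal property; uniqueness in that property yields the linearity. *)
Lemma tens_fact M V N (u : V -> mor M N) :
  (forall a v w, u (a *: v + w) = a *: u v + u w) ->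
  exists h : mor (T M V) N, forall v, h \oc tens_unit T M V v = u v.
Proof.
move=> u_lin; exists (tuncurry T (linmap_of (u_lin : linear u))) => v.
by rewrite tuncurryE.
Qed.

(** A map out of [N (x) V] is a linear family of maps out of [N]. If it kills [tensl T f V], each
    member kills [f] and descends to [Q]. *)
Lemma tensl_cokernel M N Q V (p : mor N Q) (f : mor M N) :
  is_cokernel p f -> is_cokernel (tensl T p V) (tensl T f V).
Proof.
move=> /cokernelP[pf ep U]; apply/cokernelP; split.
- by rewrite -tenslM pf tensl0.
- exact: tensl_epi.
- move=> Z g gf.
  have u v : {h | h \oc p = g \oc tens_unit T N V v}.
    by apply: cid; apply: U; rewrite -compmA -tensl_unit compmA gf comp0m.
  have [|h hu] := @tens_fact Q V Z (fun v => sval (u v)).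
    move=> a v w; apply: ep; rewrite comp_linl; do !case: (u _) => ? /= ->.
    by rewrite linearP comp_linr.
  exists h; apply: tens_ext => v; rewrite -compmA tensl_unit compmA hu.
  exact: svalP (u v).
Qed.

Lemma tensl_colimit_fact (J : smallcat) (D : diagram S J) L
    (c : forall j, mor (D j) L) V X (d : forall j, mor (T (D j) V) X) :
  is_colimit c ->
  (forall i j (a : shom i j), d j \oc tensl T (dmap D a) V = d i) ->
  exists h, forall j, h \oc tensl T (c j) V = d j.
Proof.
move=> cL dC.
have u v : {h | forall j, h \oc c j = d j \oc tens_unit T (D j) V v}.
  apply: cid; apply: (colimit_fact cL) => i j a.
  by rewrite -compmA -tensl_unit compmA dC.
have [|h hu] := @tens_fact L V X (fun v => sval (u v)).
  move=> a v w; apply: (colimit_ext cL) => j.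
  rewrite comp_linl; do !case: (u _) => ? /= ->.
  by rewrite linearP comp_linr.
exists h => j; apply: tens_ext => v; rewrite -compmA tensl_unit compmA hu.
exact: svalP (u v) j.
Qed.

(** The contraction of the second factor by a functional, with [M (x) k] identified with [M]. *)
Definition ev M V (phi : modhom k V (scalars k)) : mor (T M V) M :=
  runitV T M \oc tensr T M phi.

Lemma ev_unit M V (phi : modhom k V (scalars k)) v :
  ev M phi \oc tens_unit T M V v = phi v *: idmor M.
Proof. by rewrite /ev -compmA tensr_unit runitV_unit. Qed.

Lemma ev_natural M N V (phi : modhom k V (scalars k)) (f : mor M N) :
  ev N phi \oc tensl T f V = f \oc ev M phi.
Proof. by rewrite /ev -compmA -tensl_tensr compmA runitV_natural compmA. Qed.

Lemma ev_tensr M V W (phi : modhom k W (scalars k)) (f : modhom k V W) :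
  ev M phi \oc tensr T M f = ev M (phi \oc f).
Proof. by rewrite /ev tensrM compmA. Qed.

Lemma ev_linear M V a (phi chi : modhom k V (scalars k)) :
  ev M (a *: phi + chi) = a *: ev M phi + ev M chi.
Proof.
apply: tens_ext => v; rewrite comp_linl !ev_unit /=.
by rewrite scalerDl scalerA.
Qed.

End Tensor.

(** * Naturality of the associativity maps *)

Section Associativity.
Variables (k : fieldType) (TV : tensoring (Mod k)).
Variables (S : klincat k) (T : tensoring S).
Implicit Types (M N : S) (V W : lmodType k).

Lemma tens_ext2 M V W N (f g : mor (T M (TV V W)) N) :
  (forall v w, f \oc tens_unit T M (TV V W) (tens_unit TV V W w v)
             = g \oc tens_unit T M (TV V W) (tens_unit TV V W w v)) ->
  f = g.
Proof.
move=> fg; apply: (can_inj (@tcurryK _ _ T M (TV V W) N)).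
apply: (@tens_ext _ (Mod k) TV V W) => w; apply: linmapP => v.
by move: (fg v w); rewrite -(tcurryE f) -(tcurryE g).
Qed.

Lemma assoc_natural M N V W (phi : mor M N) :
  assoc TV T N V W \oc tensl T (tensl T phi V) W
  = tensl T phi (TV V W) \oc assoc TV T M V W.
Proof.
apply: tens_ext => w; apply: tens_ext => v.
rewrite -[in LHS](compmA _ (tensl _ _ _)) tensl_unit -[in LHS]compmA.
rewrite -[in LHS](compmA (tens_unit _ _ _ _)) tensl_unit.
rewrite [X in _ \oc X]compmA compmA assoc_unit.
by rewrite -!compmA assoc_unit tensl_unit.
Qed.

Lemma assocV_natural M N V W (phi : mor M N) :
  assocV TV T N V W \oc tensl T phi (TV V W)
  = tensl T (tensl T phi V) W \oc assocV TV T M V W.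
Proof.
apply: tens_ext2 => v w.
rewrite -!compmA tensl_unit compmA !assocV_unit.
by rewrite compmA tensl_unit -!compmA tensl_unit.
Qed.

End Associativity.

(** * The category of finite free modules over a module *)

Notation rV k n := ('rV[k]_n : lmodType k) (only parsing).

Section FiniteFreeTensor.
Variables (k : fieldType) (S : klincat k) (T : tensoring S).
Implicit Types (M N L X Y Z : S) (n : nat).

Fact coord_linear n (i : 'I_n) : linear (fun x : 'rV[k]_n => x 0 i : scalars k).
Proof. by move=> a x y; rewrite !mxE. Qed.

Definition coordinate n (i : 'I_n) : modhom k (rV k n) (scalars k) :=
  linmap_of (@coord_linear n i).

(** The dual basis expansion, tensored with [M]: it presents [M (x) k^n] as [n] copies of [M], so
    that statements about it reduce to coordinates. *)
Lemma tens_rV_id M n :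
  idmor (T M (rV k n))
  = \sum_i tens_unit T M (rV k n) (delta_mx 0 i) \oc ev T M (coordinate i).
Proof.
apply: tens_ext => x; rewrite comp1m compm_suml {1}[x]row_sum_delta.
rewrite (raddf_sum (tens_unit T M (rV k n))).
apply: eq_bigr => i _; rewrite -compmA ev_unit compmZ compm1.
exact: (linearZZ (tens_unit T M (rV k n))).
Qed.

Lemma tens_rV_exact n X Y Z (f : mor X Y) (g : mor Y Z) :
  short_exact f g -> short_exact (tensl T f (rV k n)) (tensl T g (rV k n)).
Proof.
move=> [kf cg]; split; last exact: tensl_cokernel.
have /kernelP[gf mf U] := kf; apply/kernelP; split.
- by rewrite -tenslM gf tensl0.
- apply/mono0P => W z fz; rewrite -[z]comp1m tens_rV_id.
  rewrite compm_suml big1 // => i _.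
  rewrite -compmA; suff -> : ev T X (coordinate i) \oc z = 0 by rewrite compm0.
  by apply: mf; rewrite compmA -ev_natural -compmA fz !compm0.
- move=> W z gz.
  have u i : {l | f \oc l = ev T Y (coordinate i) \oc z}.
    by apply: cid; apply: U; rewrite compmA -ev_natural -compmA gz compm0.
  exists (\sum_i tens_unit T X _ (delta_mx 0 i) \oc sval (u i)).
  rewrite compm_sumr -[RHS]comp1m tens_rV_id compm_suml; apply: eq_bigr => i _.
  by rewrite compmA tensl_unit -compmA (svalP (u i)) compmA.
Qed.

End FiniteFreeTensor.

Section FiniteFreeOver.
Variables (k : fieldType) (V : lmodType k).

(** Only the rank and the map to [V] are recorded, which keeps the index category small. *)
Definition free_over := {n : nat & modhom k (rV k n) V}.
Definition free_over_hom (i j : free_over) :=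
  {a : modhom k (rV k (tag i)) (rV k (tag j)) | tagged j \oc a = tagged i}.

Definition FreeHom (i j : free_over)
    (a : modhom k (rV k (tag i)) (rV k (tag j)))
    (e : tagged j \oc a = tagged i) : free_over_hom i j :=
  exist _ a e.

Lemma free_over_hom_eq i j (a b : free_over_hom i j) : sval a = sval b -> a = b.
Proof. by case: a b => [a ea] [b eb] /= ab; exact: eq_exist. Qed.

Fact free_over_id_subproof (i : free_over) :
  tagged i \oc idmor (rV k (tag i) : Mod k) = tagged i.
Proof. exact: compm1. Qed.

Fact free_over_comp_subproof i j l (b : free_over_hom j l)
  (a : free_over_hom i j) : tagged l \oc (sval b \oc sval a) = tagged i.
Proof. by rewrite compmA (svalP b) (svalP a). Qed.

Program Definition free_over_cat : smallcat := @SmallCat free_over free_over_hom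
  (fun i => FreeHom (free_over_id_subproof i))
  (fun i j l b a => FreeHom (free_over_comp_subproof b a)) _ _ _.
Next Obligation. by apply: free_over_hom_eq; exact: comp1m. Qed.
Next Obligation. by apply: free_over_hom_eq; exact: compm1. Qed.
Next Obligation. by apply: free_over_hom_eq; exact: compmA. Qed.

Notation FV := free_over_cat.

Fact line_linear (v : V) : linear (fun x : 'rV[k]_1 => x 0 0 *: v).
Proof. by move=> a x y; rewrite !mxE scalerDl scalerA. Qed.

Definition line (v : V) : FV := Tagged (fun n => modhom k (rV k n) V)
  (linmap_of (line_linear v) : modhom k (rV k 1) V).

Fact scale_line_linear n (x : 'rV[k]_n) :
  linear (fun y : 'rV[k]_1 => y 0 0 *: x).
Proof. by move=> a y z; rewrite !mxE scalerDl scalerA. Qed.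

Lemma line_hom (i : FV) (x : 'rV[k]_(tag i)) :
  exists a : shom (line (tagged i x)) i, forall y, sval a y = y 0 0 *: x.
Proof.
have e : tagged i \oc linmap_of (scale_line_linear x)
    = tagged (line (tagged i x)).
  by apply: linmapP => y /=; rewrite linearZ.
by exists (@FreeHom (line (tagged i x)) i _ e).
Qed.

Fact pair_linear (i j : FV) :
  linear (fun x : 'rV[k]_(tag i + tag j) =>
    tagged i (lsubmx x) + tagged j (rsubmx x)).
Proof.
by move=> a x y; rewrite !linearP scalerDr addrACA.
Qed.

Definition free_over_sum (i j : FV) : FV :=
  Tagged (fun n => modhom k (rV k n) V)
    (linmap_of (@pair_linear i j) : modhom k (rV k (tag i + tag j)) V).

Fact injl_linear m n : linear (fun x : 'rV[k]_m => row_mx x (0 : 'rV[k]_n)).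
Proof. by move=> a x y; rewrite scale_row_mx add_row_mx scaler0 addr0. Qed.

Fact injr_linear m n : linear (fun x : 'rV[k]_n => row_mx (0 : 'rV[k]_m) x).
Proof. by move=> a x y; rewrite scale_row_mx add_row_mx scaler0 addr0. Qed.

Lemma free_over_suml i j : inhabited (shom i (free_over_sum i j)).
Proof.
have e : tagged (free_over_sum i j) \oc linmap_of (@injl_linear (tag i) (tag j))
    = tagged i.
  by apply: linmapP => x /=; rewrite row_mxKl row_mxKr linear0 addr0.
by split; exact: (@FreeHom i (free_over_sum i j) _ e).
Qed.

Lemma free_over_sumr i j : inhabited (shom j (free_over_sum i j)).
Proof.
have e : tagged (free_over_sum i j) \oc linmap_of (@injr_linear (tag i) (tag j))
    = tagged j.
  by apply: linmapP => x /=; rewrite row_mxKl row_mxKr linear0 add0r.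
by split; exact: (@FreeHom j (free_over_sum i j) _ e).
Qed.

Fact mulmxr_linear m n (P : 'M[k]_(m, n)) : linear (fun x : 'rV[k]_m => x *m P).
Proof. by move=> a x y; rewrite mulmxDl scalemxAl. Qed.

(* The coequalizer of [a] and [b] is the projection onto a complement of the  *)
(* row space of [a - b], which lies in the kernel of the map to [V].          *)
Lemma free_over_filtered : is_filtered FV.
Proof.
split.
- by split; exact: (line 0).
- move=> i j; exists (free_over_sum i j); split; [exact: free_over_suml|].
  exact: free_over_sumr.
move=> i j a b.
pose D := lin1_mx (fun x => sval a x - sval b x).
have DE x : x *m D = sval a x - sval b x.
  pose f : linmap 'rV[k]_(tag i) 'rV[k]_(tag j) := sval a - sval b.
  exact: (mul_rV_lin1 f).
have tD x : (x <= D)%MS -> tagged j x = 0.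
  move=> /submxP[w ->]; rewrite DE linearB /=.
  have eab := etrans (svalP a) (esym (svalP b)).
  have := congr1 (fun f : linmap _ _ => f w) eab.
  by move=> /= ->; rewrite subrr.
(* [D] is rectangular; [<<D>>] is a square matrix with the same row space, as [proj_mx] requires. *)
pose P := proj_mx D^C%MS <<D>>%MS.
have capD : (D^C :&: <<D>> = 0)%MS.
  apply/eqP; rewrite -submx0 (cap_eqmx (eqmx_refl _) (genmxE D)).
  by rewrite capmxC capmx_compl.
have PQ x : x = x *m P + x *m proj_mx <<D>>%MS D^C%MS :> 'rV_(tag j).
  rewrite add_proj_mx //.
  apply: submx_full; rewrite addsmxC /row_full.
  rewrite (adds_eqmx (genmxE D) (eqmx_refl _)) -/(row_full _).
  exact: addsmx_compl_full.
have e : tagged j \oc linmap_of (mulmxr_linear P) = tagged j.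
  apply: linmapP => x /=; rewrite [in RHS](PQ x) linearD /=.
  rewrite [X in _ + X]tD ?addr0 //.
  by rewrite -(genmxE D) proj_mx_sub.
exists j, (@FreeHom j j _ e); apply: free_over_hom_eq; apply: linmapP => x /=.
apply/eqP; rewrite -subr_eq0 -mulmxBl -DE; apply/eqP.
by rewrite proj_mx_0 // genmxE submxMl.
Qed.

End FiniteFreeOver.

(** * Filtered colimits and exactness of the tensor product *)

Section LazardColimit.
Variables (k : fieldType) (S : klincat k) (T : tensoring S).
Variables (V : lmodType k).
Implicit Types (M N L X Y Z : S) (n : nat).

Notation FV := (free_over_cat V).

Program Definition free_diagram M : diagram S FV :=
  @Diagram k S FV (fun i => T M (rV k (tag i)))
    (fun i j a => tensr T M (sval a)) _ _.
Next Obligation. exact: tensr1. Qed.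
Next Obligation. exact: tensrM. Qed.

Definition free_cocone M (i : FV) : mor (free_diagram M i) (T M V) :=
  tensr T M (tagged i).

(** Every vector [v] is hit by the object [line v], so a cocone is determined by its legs at lines;
    filteredness makes the resulting family linear in [v]. *)
Lemma free_colimit M : is_colimit (free_cocone M).
Proof.
have tE (i : FV) x : free_cocone M i \oc tens_unit T M _ x
    = tens_unit T M V (tagged i x).
  exact: tensr_unit.
apply: colimitI.
- move=> i j a; rewrite -[LHS]tensrM; congr tensr; exact: (svalP a).
- move=> X f g fg; apply: tens_ext => v.
  have tv : tens_unit T M V v
      = free_cocone M (line v) \oc tens_unit T M (rV k 1) (delta_mx 0 0).
    by rewrite (tE (line v)) /= !mxE eqxx scale1r.
  by rewrite tv !compmA; congr (_ \oc _); exact: fg.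
- move=> X d dC.
  pose u v : mor M X := d (line v) \oc tens_unit T M _ (delta_mx 0 0).
  have uE (i : FV) x : d i \oc tens_unit T M _ x = u (tagged i x).
    have [a aE] := line_hom x.
    rewrite /u -(dC _ _ a) -compmA; congr (_ \oc _).
    by rewrite /= tensr_unit aE !mxE eqxx scale1r.
  have [a v w|h hu] := @tens_fact _ _ T M V X u.
    (* Both vectors lift to the single object [s], where additivity is that of one leg of the
       cocone. *)
    have [al] := free_over_suml (line v) (line w).
    have [ar] := free_over_sumr (line v) (line w).
    set s := free_over_sum _ _ in al ar.
    pose x : 'rV[k]_(tag s) := sval al (delta_mx 0 0).
    pose y : 'rV[k]_(tag s) := sval ar (delta_mx 0 0).
    have sx : tagged s x = v.
      have := congr1 (fun f : linmap _ _ => f (delta_mx 0 0)) (svalP al).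
      by rewrite /= => ->; rewrite !mxE eqxx scale1r.
    have sy : tagged s y = w.
      have := congr1 (fun f : linmap _ _ => f (delta_mx 0 0)) (svalP ar).
      by rewrite /= => ->; rewrite !mxE eqxx scale1r.
    rewrite -sx -sy -linearP -!uE.
    by rewrite (linearP (tens_unit T M (rV k (tag s)))) comp_linr.
  by exists h => i; apply: tens_ext => x; rewrite -compmA tE hu uE.
Qed.

Lemma tensl_natural M N (f : mor M N) :
  is_natural (D := free_diagram M) (E := free_diagram N)
    (fun i => tensl T f (rV k (tag i))).
Proof. by move=> i j a; exact: tensl_tensr. Qed.

Hypothesis groS : is_grothendieck S.
Let abS := grothendieck_abelian groS.

Lemma tensl_exact X Y Z (f : mor X Y) (g : mor Y Z) :
  short_exact f g -> short_exact (tensl T f V) (tensl T g V).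
Proof.
move=> fg.
apply: (grothendieck_filtered_exact groS (free_over_filtered V)
  (tensl_natural f) (tensl_natural g) _ (free_colimit X) (free_colimit Y)
  (free_colimit Z)).
- by move=> j; exact: tens_rV_exact.
- by move=> j; exact: tensl_tensr.
- by move=> j; exact: tensl_tensr.
Qed.

Lemma tensl_mono X Y (f : mor X Y) : mono f -> mono (tensl T f V).
Proof.
move=> mf; have [Q [p cp]] := has_cokernels abS f.
have := @tensl_exact _ _ _ f p (conj (mono_kernel_coker abS mf cp) cp).
by case=> /kernel_mono.
Qed.

(** Factoring [f] through its image, [i] is also a kernel of the epi part, which completes it to a
    short exact sequence; the mono part stays mono after tensoring. *)
Lemma tensl_kernel K X Y (i : mor K X) (f : mor X Y) :
  is_kernel i f -> is_kernel (tensl T i V) (tensl T f V).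
Proof.
have [I [j [e [mj ee ->]]]] := image_factorization abS f.
move=> /(kernel_of_mono_comp _ _ mj) ki.
rewrite tenslM; apply/(kernel_of_mono_comp _ _ (tensl_mono mj)).
by have [] := @tensl_exact _ _ _ i e (conj ki (epi_coker_kernel abS ee ki)).
Qed.

End LazardColimit.

(** * Kernels and monomorphisms in filtered colimits *)

Section FilteredColimit.
Variables (k : fieldType) (S : klincat k).
Hypothesis groS : is_grothendieck S.
Let abS := grothendieck_abelian groS.
Variables (J : smallcat) (J_filtered : is_filtered J).

Section ObjectwiseKernel.
Variables (D E : diagram S J) (t : forall j, mor (D j) (E j)).
Hypothesis t_nat : is_natural t.

Lemma diagram_kernel : exists (K : diagram S J) (s : forall j, mor (K j) (D j)),
  is_natural s /\ forall j, is_kernel (s j) (t j).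
Proof.
have kj j : {K : S & {i : mor K (D j) | is_kernel i (t j)}}.
  by have [K /cid[i ki]] := cid (has_kernels abS (t j)); exists K, i.
pose s j := sval (tagged (kj j)).
have sK j : is_kernel (s j) (t j) := svalP (tagged (kj j)).
have ms j : mono (s j) := kernel_mono (sK j).
have hj i j (a : shom i j) : {h | s j \oc h = dmap D a \oc s i}.
  apply: cid; have /kernelP[_ _] := sK j; apply.
  have /kernelP[ts _ _] := sK i.
  by rewrite compmA t_nat -compmA ts compm0.
have hE i j (a : shom i j) := svalP (hj i j a).
have h1 i : sval (hj i i (sid i)) = idmor (tag (kj i)).
  by apply: ms; rewrite hE dmap1 comp1m compm1.
have hM i j l (b : shom j l) (a : shom i j) :
    sval (hj i l (scomp b a)) = sval (hj j l b) \oc sval (hj i j a).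
  by apply: ms; rewrite hE dmapM compmA hE -!compmA hE.
exists (@Diagram k S J (fun j => tag (kj j)) _ h1 hM), s; split=> //.
Qed.

Lemma diagram_cokernel :
  exists (Q : diagram S J) (s : forall j, mor (E j) (Q j)),
  is_natural s /\ forall j, is_cokernel (s j) (t j).
Proof.
have kj j : {Q : S & {p : mor (E j) Q | is_cokernel p (t j)}}.
  by have [K /cid[i ki]] := cid (has_cokernels abS (t j)); exists K, i.
pose s j := sval (tagged (kj j)).
have sK j : is_cokernel (s j) (t j) := svalP (tagged (kj j)).
have ms j : epi (s j) := cokernel_epi (sK j).
have hj i j (a : shom i j) : {h | h \oc s i = s j \oc dmap E a}.
  apply: cid; have /cokernelP[_ _] := sK i; apply.
  have /cokernelP[ts _ _] := sK j.
  by rewrite -compmA -t_nat compmA ts comp0m.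
have hE i j (a : shom i j) := svalP (hj i j a).
have h1 i : sval (hj i i (sid i)) = idmor (tag (kj i)).
  by apply: ms; rewrite hE dmap1 comp1m compm1.
have hM i j l (b : shom j l) (a : shom i j) :
    sval (hj i l (scomp b a)) = sval (hj j l b) \oc sval (hj i j a).
  by apply: ms; rewrite hE dmapM -compmA hE !compmA hE.
exists (@Diagram k S J (fun j => tag (kj j)) _ h1 hM), s; split=> // i j a.
exact: esym (hE _ _ _).
Qed.

(** AB5 is stated for short exact sequences, so the objectwise monos are first completed by their
    cokernels. *)
Lemma filtered_colimit_mono LD LE (cD : forall j, mor (D j) LD)
    (cE : forall j, mor (E j) LE) (u : mor LD LE) :
  (forall j, mono (t j)) -> is_colimit cD -> is_colimit cE ->
  (forall j, u \oc cD j = cE j \oc t j) -> mono u.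
Proof.
move=> mt lD lE uE.
have [Q [s [s_nat cs]]] := diagram_cokernel.
have [LQ [cQ lQ]] := grothendieck_cocomplete groS Q.
have [|v vE] := @colimit_fact _ _ _ _ _ _ _ (fun j => cQ j \oc s j) lE.
  by move=> i j a; rewrite -compmA s_nat compmA (proj1 lQ).
have st j : short_exact (t j) (s j).
  by split=> //; exact: mono_kernel_coker (mt j) (cs j).
have [/kernel_mono //] := grothendieck_filtered_exact groS J_filtered
  t_nat s_nat st lD lE lQ uE vE.
Qed.

End ObjectwiseKernel.

Program Definition constant_diagram (W : S) : diagram S J :=
  @Diagram k S J (fun=> W) (fun _ _ _ => idmor W) _ _.
Next Obligation. by rewrite comp1m. Qed.

Lemma constant_colimit (W : S) :
  is_colimit (D := constant_diagram W) (fun j => idmor W).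
Proof.
have [[j0] jj _] := J_filtered.
apply: colimitI => [i j a|X f g fg|X d dC]; first by rewrite compm1.
  by have := fg j0; rewrite !compm1.
have eq_d i j : d i = d j.
  by have [l [[a] [b]]] := jj i j; rewrite -(dC _ _ a) -(dC _ _ b).
by exists (d j0) => j; rewrite compm1.
Qed.

(* The union over j of the kernels of D j -> W is the kernel of L -> W. *)
Lemma filtered_kernel_eq0 (D : diagram S J) L (c : forall j, mor (D j) L)
    W (p : mor L W) K (i : mor K L) R (r : mor K R) :
  is_colimit c -> is_kernel i p ->
  (forall j Z (z : mor Z (D j)) (z' : mor Z K),
     i \oc z' = c j \oc z -> r \oc z' = 0) ->
  r = 0.
Proof.
move=> cL ki r0; have /kernelP[pi mi U] := ki.
pose t j : mor (D j) (constant_diagram W j) := p \oc c j.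
have t_nat : is_natural t.
  by move=> i' j a; rewrite /t -compmA (proj1 cL) comp1m.
have [Kd [s [s_nat sK]]] := diagram_kernel t_nat.
(* The [I j] are the coimages of the maps [D j -> W]; AB5 will make the colimit of the kernels the
   kernel of [L -> LI]. *)
have [I [q [q_nat qC]]] := diagram_cokernel s_nat.
have [LK [cK lK]] := grothendieck_cocomplete groS Kd.
have [LI [cI lI]] := grothendieck_cocomplete groS I.
have ms j := kernel_mono (sK j).
have eq_ j := cokernel_epi (qC j).
have sq j : short_exact (s j) (q j).
  by split=> //; exact: mono_kernel_coker.
have [|u uE] := @colimit_fact _ _ _ _ _ _ _ (fun j => c j \oc s j) lK.
  by move=> a b f; rewrite -compmA s_nat compmA (proj1 cL).
have [|v vE] := @colimit_fact _ _ _ _ _ _ _ (fun j => cI j \oc q j) cL.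
  by move=> a b f; rewrite -compmA q_nat compmA (proj1 lI).
have [ku cv] := grothendieck_filtered_exact groS J_filtered s_nat q_nat sq
  lK cL lI uE vE.
have mj j : {m : mor (I j) W | m \oc q j = t j}.
  apply: cid; have /cokernelP[_ _] := qC j; apply.
  by have /kernelP[] := sK j.
(* Coimage and image agree, both being cokernels of [s j]. *)
have mm j : mono (sval (mj j)).
  have [X [j' [e [mj' ee te]]]] := image_factorization abS (t j).
  have /(epi_coker_kernel abS ee) ce : is_kernel (s j) e.
    by apply/(kernel_of_mono_comp _ _ mj'); rewrite -te.
  have /cokernelP[es _ Ue] := ce; have /cokernelP[qs _ Uq] := qC j.
  have [g gq] := Uq _ _ es; have [g' ge] := Ue _ _ qs.
  have -> : sval (mj j) = j' \oc g.
    by apply: eq_; rewrite (svalP (mj j)) -compmA gq.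
  apply: mono_comp => //; apply: (@split_mono _ _ _ _ _ g').
  by apply: eq_; rewrite -compmA gq ge comp1m.
have m_nat : is_natural (E := constant_diagram W) (fun j => sval (mj j)).
  move=> a b f; rewrite /= comp1m; apply: eq_.
  by rewrite -compmA -q_nat compmA !(svalP (mj _)) t_nat comp1m.
have [|w wE] := @colimit_fact _ _ _ _ _ _ _ (fun j => sval (mj j)) lI.
  by move=> a b f; rewrite m_nat comp1m.
have mw : mono w.
  apply: (filtered_colimit_mono m_nat mm lI (constant_colimit W)) => j.
  by rewrite comp1m.
(* Since [w] is mono, [p] and [v] have the same kernel, namely the colimit [LK] of the objectwise
   kernels. *)
have pE : p = w \oc v.
  by apply: (colimit_ext cL) => j; rewrite -compmA vE compmA wE (svalP (mj j)).
have /kernelP[vu mu Uu] := ku.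
have [z uz] : exists z, u \oc z = i.
  by apply: Uu; apply: mw; rewrite compmA -pE pi compm0.
have [z' iz'] : exists z', i \oc z' = u.
  by apply: U; rewrite pE -compmA vu compm0.
suff rz' : r \oc z' = 0.
  have z'z : z' \oc z = idmor K by apply: mi; rewrite compmA iz' uz compm1.
  by rewrite -[r]compm1 -z'z compmA rz' comp0m.
apply: (colimit_ext lK) => j; rewrite comp0m -compmA; apply: r0.
by rewrite compmA iz' uE.
Qed.

End FilteredColimit.

(** * Evaluation at functionals *)

(** By Zorn, a subspace containing [H] and maximal among those missing [v] is a hyperplane
    complementary to the line of [v]; [phi] is the coordinate along [v]. *)
Lemma separating_functional (k : fieldType) (V : lmodType k) (H : V -> Prop)
    (v : V) :
  H 0 -> (forall a x y, H x -> H y -> H (a *: x + y)) -> ~ H v ->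
  exists phi : modhom k V (scalars k), phi v = 1 /\ forall w, H w -> phi w = 0.
Proof.
move=> H0 HD Hv.
pose closed (A : V -> Prop) := forall a x y, A x -> A y -> A (a *: x + y).
(* Containing [H] is required of nonempty [A] only, so that the union of the empty chain also
   satisfies [P]. *)
pose P (A : V -> Prop) :=
  [/\ closed A, ~ A v & forall x, A x -> forall w, H w -> A w].
have [|A [[Acl Av AH] Amax]] := @classical_sets.Zorn_bigcup V P.
  move=> F FP Ftot; split.
  - move=> a x y [X FX Xx] [Y FY Yy].
    by have [XY|YX] := Ftot _ _ FX FY; [exists Y|exists X] => //;
      [have [Ycl _ _] := FP _ FY; apply: Ycl => //; apply: XY
      |have [Xcl _ _] := FP _ FX; apply: Xcl => //; apply: YX].
  - by move=> [X FX Xv]; have [_] := FP _ FX.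
  - move=> x [X FX Xx] w Hw; exists X => //.
    by have [_ _ XH] := FP _ FX; apply: XH Xx w Hw.
have A0 : A 0.
  apply: contrapT => nA0; apply: (Amax H); last by split=> // x _ w.
  have nA x : ~ A x.
    by move=> Ax; apply: nA0; rewrite -(addNr x) -scaleN1r; apply: Acl.
  by split=> [x /nA //|HA]; apply/nA0/HA.
have {}AH : forall w, H w -> A w by apply: AH A0.
have AZ a x : A x -> A (a *: x).
  by move=> Ax; rewrite -[_ *: _]addr0; apply: Acl.
have ex w : {a : k | A (w - a *: v)}.
  apply: cid; have [Aw|nAw] := pselect (A w).
    by exists 0; rewrite scale0r subr0.
  (* [B] is the span of [A] and [w]. Being larger than [A], it contains [v] by maximality, and
     solving [v = y + b *: w] for [w] gives the coefficient [b^-1]. *)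
  pose B x := exists y b, A y /\ x = y + b *: w.
  have AB x : A x -> B x by exists x, 0; rewrite scale0r addr0.
  have [y [b [Ay ev]]] : B v.
    apply: contrapT => nBv; apply: (Amax B); first split=> // BA.
      by apply: nAw; apply: BA; exists 0, 1; rewrite scale1r add0r.
    split=> // [a x y [x1 [b [Ax ->]]] [y1 [c [Ay ->]]]|x _ z Hz].
      2: exact/AB/AH.
    exists (a *: x1 + y1), (a * b + c); split; first exact: Acl.
    by rewrite scalerDr scalerDl scalerA addrACA.
  have b0 : b != 0.
    by apply/eqP => b0; apply: Av; rewrite ev b0 scale0r addr0.
  exists b^-1; rewrite ev scalerDr scalerA mulVf // scale1r.
  rewrite opprD addrCA subrr addr0.
  by rewrite -scaleN1r scalerA; apply: AZ.
have phiU w a : A (w - a *: v) -> sval (ex w) = a.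
  move=> Aa; apply/eqP; rewrite -subr_eq0; apply: contrapT => /negP ne.
  apply: Av; rewrite -[v]scale1r -(mulVf ne) -scalerA; apply: (AZ).
  have := Acl (-1) _ _ (svalP (ex w)) Aa.
  by rewrite scaleN1r opprB addrA addrNK -scalerBl.
have phi_lin : linear (fun w => sval (ex w) : scalars k).
  move=> a x y; apply: phiU.
  have := Acl a _ _ (svalP (ex x)) (svalP (ex y)).
  by rewrite scalerBr scalerA addrACA -opprD -scalerDl.
exists (linmap_of phi_lin); split=> [|w Hw]; apply: phiU.
  by rewrite scale1r subrr.
by rewrite scale0r subr0; apply: AH.
Qed.

Lemma finite_rank_linear (k : fieldType) (V : lmodType k)
    (r : seq (modhom k V (scalars k) * V)) :
  linear (fun x => \sum_(q <- r) (q.1 x : k) *: q.2).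
Proof.
move=> a x y; rewrite scaler_sumr -big_split; apply: eq_bigr => q _.
by rewrite linearP /= scalerDl scalerA.
Qed.

(** The list [r] encodes a finite rank endomorphism [p]. If [p] does not fix the new vector [v], the
    correction [phi (x) (v - p v)] makes it do so, with [phi v = 1] and [phi] zero on the fixed
    space of [p]. *)
Lemma finite_rank_fixing (k : fieldType) (V : lmodType k) (s : seq V) :
  exists r : seq (modhom k V (scalars k) * V),
    forall x, x \in s -> x = \sum_(q <- r) (q.1 x : k) *: q.2.
Proof.
elim: s => [|v s [r rE]]; first by exists [::].
pose p (x : V) := \sum_(q <- r) (q.1 x : k) *: q.2.
have p_lin : linear p := @finite_rank_linear _ _ r.
have [pv|pv] := pselect (v = p v).
  by exists r => x; rewrite inE => /predU1P[-> //|]; apply: rE.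
have [||//|phi [phiv phi0]] := @separating_functional k V (fun x => x = p x) v.
- by rewrite /p big1 // => q _; rewrite linear0 scale0r.
- by move=> a x y ex ey; rewrite p_lin -ex -ey.
exists ((phi, v - p v) :: r) => x; rewrite inE => /predU1P[->|xs].
  by rewrite big_cons /= phiv scale1r subrK.
by rewrite big_cons /= -rE // phi0 ?scale0r ?add0r //; apply: rE.
Qed.

Lemma linmap_rV_ext (k : fieldType) (V : lmodType k) n
    (f g : modhom k (rV k n) V) :
  (forall i, f (delta_mx 0 i) = g (delta_mx 0 i)) -> f = g.
Proof.
move=> fg; apply: linmapP => x.
have hE (h : modhom k (rV k n) V) : h x = \sum_i x 0 i *: h (delta_mx 0 i).
  rewrite {1}[x]row_sum_delta; apply: etrans (raddf_sum h _ _ _) _.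
  by apply: eq_bigr => i _; exact: (linearZZ h).
by rewrite !hE; apply: eq_bigr => i _; rewrite fg.
Qed.

Section JointlyMono.
Variables (k : fieldType) (S : klincat k) (T : tensoring S).
Hypothesis groS : is_grothendieck S.
Let abS := grothendieck_abelian groS.

(** The image of [y] is killed by all contractions. On its part coming from some [X (x) k^n], only a
    finite-dimensional part of [V] matters, and there finitely many functionals recover every
    vector. *)
Lemma ev_jointly_mono (V : lmodType k) Z X (y : mor Z (T X V)) :
  (forall phi : modhom k V (scalars k), ev T X phi \oc y = 0) -> y = 0.
Proof.
move=> y0; have [W [p /cokernelP[py ep Up]]] := has_cokernels abS y.
have [K [i ki]] := has_kernels abS p; have /kernelP[pi mi Ui] := ki.
suff i0 : i = 0 by have [h <-] := Ui _ _ py; rewrite i0 comp0m.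
have evi phi : ev T X phi \oc i = 0.
  by have [h <-] := Up _ _ (y0 phi); rewrite -compmA pi compm0.
have := @filtered_kernel_eq0 _ _ groS _ (free_over_filtered V)
  _ _ _ _ _ _ _ _ i (@free_colimit _ _ T V X) ki.
apply.
move=> j W' z z' iz; rewrite iz.
(* The finite rank endomorphism fixes the images of the basis vectors, so the leg at [j] becomes a
   sum of maps factoring through contractions, each of which vanishes on [i]. *)
have [r rE] :=
  finite_rank_fixing [seq tagged j (delta_mx 0 l) | l : 'I_(tag j)].
have r_lin : linear (fun w : V => \sum_(q <- r) (q.1 w : k) *: q.2).
  exact: finite_rank_linear.
have jE : tagged j = (linmap_of r_lin : modhom k V V) \oc tagged j.
  apply: linmap_rV_ext => l; apply: rE; apply/imageP; exists l => //.
have cE : free_cocone T X j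
    = \sum_(q <- r) tens_unit T X V q.2 \oc ev T X (q.1 \oc tagged j).
  apply: tens_ext => x; rewrite /free_cocone tensr_unit {1}jE.
  rewrite (raddf_sum (tens_unit T X V)) compm_suml.
  apply: eq_bigr => q _; rewrite -compmA ev_unit compmZ compm1.
  exact: (linearZZ (tens_unit T X V)).
rewrite cE compm_suml big1 // => q _.
rewrite -compmA -ev_tensr -compmA -[_ \oc z]iz [ev _ _ _ \oc _]compmA.
by rewrite evi comp0m compm0.
Qed.

End JointlyMono.

(** * Transfer of entwined structures *)

Section EntwinedStructures.
Variables (k : fieldType) (TV : tensoring (Mod k)).
Variables (S : klincat k) (T : tensoring S).
Variables (A : algebra TV) (C : coalgebra TV) (psi : mor (TV C A) (TV A C)).
Implicit Types (M N L : S).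

Definition entwine M : mor (T (T M C) A) (T (T M A) C) :=
  assocV TV T M A C \oc tensr T M psi \oc assoc TV T M C A.

Definition is_entwined M (d : mor M (T M C)) (a : mor (T M A) M) :=
  [/\ is_comodule_object d, is_module_object a
    & d \oc a = tensl T a C \oc entwine M \oc tensl T d A].

(** Rewriting device: replaces a commuting square at the end of a left-associated composite. *)
Lemma compm_sqr (W X Y Y' Z : S) (b : mor Y Z) (c : mor X Y) (b' : mor Y' Z)
    (c' : mor X Y') (x : mor Z W) :
  b \oc c = b' \oc c' -> x \oc b \oc c = x \oc b' \oc c'.
Proof. by rewrite -!compmA => ->. Qed.

Lemma entwine_natural M N (c : mor M N) :
  entwine N \oc tensl T (tensl T c C) A = tensl T (tensl T c A) C \oc entwine M.
Proof.
rewrite /entwine (compm_sqr _ (assoc_natural _ _ _ _ _)).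
by rewrite (compm_sqr _ (esym (tensl_tensr _ _ _))) assocV_natural !compmA.
Qed.

(** * Naturality of the two sides of each axiom *)

Section Morphism.
Variables (M N : S) (dM : mor M (T M C)) (aM : mor (T M A) M).
Variables (dN : mor N (T N C)) (aN : mor (T N A) N) (c : mor M N).
Hypothesis cd : dN \oc c = tensl T c C \oc dM.
Hypothesis ca : c \oc aM = aN \oc tensl T c A.

Lemma coassocl_natural :
  assocV TV T N C C \oc tensr T N (coalg_comul C) \oc dN \oc c =
  tensl T (tensl T c C) C
    \oc (assocV TV T M C C \oc tensr T M (coalg_comul C) \oc dM).
Proof.
rewrite (compm_sqr _ cd) (compm_sqr _ (esym (tensl_tensr _ _ _))).
by rewrite assocV_natural !compmA.
Qed.

Lemma coassocr_natural :
  tensl T dN C \oc dN \oc c = tensl T (tensl T c C) C \oc (tensl T dM C \oc dM).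
Proof. by rewrite (compm_sqr _ cd) -tenslM cd tenslM compmA. Qed.

Lemma counit_natural :
  runitV T N \oc tensr T N (coalg_counit C) \oc dN \oc c =
  c \oc (runitV T M \oc tensr T M (coalg_counit C) \oc dM).
Proof.
rewrite (compm_sqr _ cd) (compm_sqr _ (esym (tensl_tensr _ _ _))).
by rewrite runitV_natural !compmA.
Qed.

Lemma assocl_natural :
  aN \oc tensr T N (alg_mul A) \oc assoc TV T N A A
    \oc tensl T (tensl T c A) A =
  c \oc (aM \oc tensr T M (alg_mul A) \oc assoc TV T M A A).
Proof.
rewrite (compm_sqr _ (assoc_natural _ _ _ _ _)).
by rewrite (compm_sqr _ (esym (tensl_tensr _ _ _))) -ca !compmA.
Qed.

Lemma assocr_natural :
  aN \oc tensl T aN A \oc tensl T (tensl T c A) A = c \oc (aM \oc tensl T aM A).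
Proof. by rewrite -compmA -tenslM -ca tenslM !compmA ca. Qed.

Lemma unit_natural :
  aN \oc tensr T N (alg_one A) \oc runit T N \oc c =
  c \oc (aM \oc tensr T M (alg_one A) \oc runit T M).
Proof.
rewrite (compm_sqr _ (esym (runit_natural _ _))).
by rewrite (compm_sqr _ (esym (tensl_tensr _ _ _))) -ca !compmA.
Qed.

Lemma compatl_natural :
  dN \oc aN \oc tensl T c A = tensl T c C \oc (dM \oc aM).
Proof. by rewrite (compm_sqr _ (esym ca)) cd compmA. Qed.

Lemma compatr_natural :
  tensl T aN C \oc entwine N \oc tensl T dN A \oc tensl T c A =
  tensl T c C \oc (tensl T aM C \oc entwine M \oc tensl T dM A).
Proof.
rewrite -[LHS]compmA -tenslM cd tenslM compmA.
by rewrite (compm_sqr _ (entwine_natural c)) -tenslM -ca tenslM !compmA.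
Qed.

End Morphism.

(** Each axiom for [N] equates maps out of [N], [N (x) A] or [(N (x) A) (x) A], and the legs stay
    jointly epic after tensoring. *)
Lemma is_entwined_jointly_epi (I : Type) (M : I -> S)
    (dM : forall i, mor (M i) (T (M i) C))
    (aM : forall i, mor (T (M i) A) (M i))
    N (dN : mor N (T N C)) (aN : mor (T N A) N) (c : forall i, mor (M i) N) :
  jointly_epi c -> (forall i, is_entwined (dM i) (aM i)) ->
  (forall i, dN \oc c i = tensl T (c i) C \oc dM i) ->
  (forall i, c i \oc aM i = aN \oc tensl T (c i) A) ->
  is_entwined dN aN.
Proof.
move=> cE Mi cd ca; have cAE := tensl_jointly_epi (T := T) (V := A) cE.
have cAAE := tensl_jointly_epi (T := T) (V := A) cAE.
split; first split; last 2 first.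
- split; [apply: cAAE | apply: cE] => i.
    have [_ [mA _] _] := Mi i.
    by rewrite (assocl_natural (ca i)) (assocr_natural (ca i)) mA.
  have [_ [_ m1] _] := Mi i.
  by rewrite (unit_natural (ca i)) m1 comp1m compm1.
- apply: cAE => i; have [_ _ cM] := Mi i.
  by rewrite (compatl_natural (cd i) (ca i)) (compatr_natural (cd i) (ca i)) cM.
- apply: cE => i; have [[cA _] _ _] := Mi i.
  by rewrite (coassocl_natural (cd i)) (coassocr_natural (cd i)) cA.
- apply: cE => i; have [[_ c1] _ _] := Mi i.
  by rewrite (counit_natural (cd i)) c1 comp1m compm1.
Qed.

(** Dually, each axiom for [M] equates maps into [M], [M (x) C] or [(M (x) C) (x) C], whence the
    three monos. *)
Lemma is_entwined_mono M N (dM : mor M (T M C)) (aM : mor (T M A) M)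
    (dN : mor N (T N C)) (aN : mor (T N A) N) (c : mor M N) :
  mono c -> mono (tensl T c C) -> mono (tensl T (tensl T c C) C) ->
  is_entwined dN aN ->
  dN \oc c = tensl T c C \oc dM -> c \oc aM = aN \oc tensl T c A ->
  is_entwined dM aM.
Proof.
move=> mc mcC mcCC [[cA c1] [mA m1] cM] cd ca.
split; first split; last 2 first.
- split; apply: mc.
    by rewrite -(assocl_natural ca) -(assocr_natural ca) mA.
  by rewrite -(unit_natural ca) m1 comp1m compm1.
- by apply: mcC; rewrite -(compatl_natural cd ca) -(compatr_natural cd ca) cM.
- by apply: mcCC; rewrite -(coassocl_natural cd) -(coassocr_natural cd) cA.
- by apply: mc; rewrite -(counit_natural cd) c1 comp1m compm1.
Qed.

End EntwinedStructures.

(** * The forgetful functor *)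

Section EntwinedCategory.
Variables (k : fieldType) (TV : tensoring (Mod k)).
Variables (S : klincat k) (T : tensoring S).
Variables (A : algebra TV) (C : coalgebra TV) (psi : mor (TV C A) (TV A C)).

Notation E := (entwined_category T psi).
Implicit Types (X Y Z : E).

Definition carrier (X : E) : S := @ec_obj _ _ _ _ _ _ _ X.
Definition coaction (X : E) : mor (carrier X) (T (carrier X) C) := ec_coact X.
Definition action (X : E) : mor (T (carrier X) A) (carrier X) := ec_act X.
Definition forget (X Y : E) (f : mor X Y) : mor (carrier X) (carrier Y) :=
  @ehom _ _ _ _ _ _ _ X Y f.


Lemma forget1 X : forget (idmor X) = idmor (carrier X).
Proof. by []. Qed.

Lemma forgetM X Y Z (g : mor Y Z) (f : mor X Y) :
  forget (g \oc f) = forget g \oc forget f.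
Proof. by []. Qed.

Lemma forget_inj X Y : injective (@forget X Y).
Proof. exact: val_inj. Qed.

Lemma forget_colinear X Y (f : mor X Y) :
  coaction Y \oc forget f = tensl T (forget f) C \oc coaction X.
Proof. by have /asboolP[] := @ehomP _ _ _ _ _ _ _ X Y f. Qed.

Lemma forget_alinear X Y (f : mor X Y) :
  forget f \oc action X = action Y \oc tensl T (forget f) A.
Proof. by have /asboolP[] := @ehomP _ _ _ _ _ _ _ X Y f. Qed.

Lemma forget_full X Y (h : mor (carrier X) (carrier Y)) :
  coaction Y \oc h = tensl T h C \oc coaction X ->
  h \oc action X = action Y \oc tensl T h A -> exists f, forget f = h.
Proof.
move=> hC hA.
have hP : @entwined_pred _ _ _ _ _ _ psi X Y h by apply/asboolP.
by exists (EntwinedHom hP : mor X Y).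
Qed.

Lemma carrier_is_entwined X : is_entwined psi (coaction X) (action X).
Proof.
case: X => M d a cM mM; rewrite /coaction /action /= => dM; split=> //.
by rewrite /entwine !compmA.
Qed.

Lemma entwined_comodule_of M (d : mor M (T M C)) (a : mor (T M A) M) :
  is_entwined psi d a -> d \oc a = tensl T a C \oc assocV TV T M A C
    \oc tensr T M psi \oc assoc TV T M C A \oc tensl T d A.
Proof. by case=> _ _ ->; rewrite /entwine !compmA. Qed.

Definition entwined_object M (d : mor M (T M C)) (a : mor (T M A) M)
    (H : is_entwined psi d a) : E :=
  EntwinedComodule (let: And3 H1 _ _ := H in H1) (let: And3 _ H2 _ := H in H2)
    (entwined_comodule_of H).

(** Jointly epic families are final for the forgetful functor: compatibility of [h] with both
    structures can be tested on the legs. *)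
Lemma forget_final (I : Type) (X : I -> E) L (c : forall i, mor (X i) L) Y
    (h : mor (carrier L) (carrier Y)) (d : forall i, mor (X i) Y) :
  jointly_epi (fun i => forget (c i)) ->
  (forall i, h \oc forget (c i) = forget (d i)) -> exists f, forget f = h.
Proof.
move=> cE hc; have cEA := tensl_jointly_epi (T := T) (V := A) cE.
apply: forget_full; [apply: cE|apply: cEA] => i.
  rewrite -compmA hc forget_colinear -hc tenslM -!compmA; congr (_ \oc _).
  by rewrite forget_colinear.
rewrite -compmA -forget_alinear compmA hc forget_alinear -hc tenslM.
by rewrite compmA.
Qed.

Lemma entwined_final (I : Type) (X : I -> E) L
    (c : forall i, mor (carrier (X i)) L) (d : mor L (T L C))
    (a : mor (T L A) L) :
  jointly_epi c ->
  (forall i, d \oc c i = tensl T (c i) C \oc coaction (X i)) ->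
  (forall i, c i \oc action (X i) = a \oc tensl T (c i) A) ->
  exists H : is_entwined psi d a, forall i,
    exists f : mor (X i) (entwined_object H), forget f = c i.
Proof.
move=> cE cd ca.
have H := is_entwined_jointly_epi cE (fun i => carrier_is_entwined (X i)) cd ca.
by exists H => i; apply: (@forget_full (X i) (entwined_object H)).
Qed.

Lemma forget_cokernel_reflect X Y Q (p : mor Y Q) (f : mor X Y) :
  is_cokernel (forget p) (forget f) -> is_cokernel p f.
Proof.
move=> /cokernelP[pf ep U]; apply/cokernelP; split.
- exact: forget_inj.
- by move=> Z g h /(congr1 (@forget _ _)) /ep/forget_inj.
- move=> Z g gf; have [h hp] := U _ (forget g) (congr1 (@forget _ _) gf).
  have [||h' h'E] := @forget_final unit _ Q (fun=> p) Z h (fun=> g) => //.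
    by move=> W u v /(_ tt)/ep.
  by exists h'; apply: forget_inj; rewrite forgetM h'E.
Qed.

Lemma forget_cokernel_lift X Y (f : mor X Y) :
  (exists Q (p : mor (carrier Y) Q), is_cokernel p (forget f)) ->
  exists Q (p : mor Y Q), is_cokernel (forget p) (forget f).
Proof.
move=> [Q [p cp]]; have /cokernelP[pf ep U] := cp.
have /cokernelP[pfA epA UA] := tensl_cokernel T A cp.
have [d dp] : exists d, d \oc p = tensl T p C \oc coaction Y.
  by apply: U; rewrite -compmA forget_colinear compmA -tenslM pf tensl0 comp0m.
have [a ap] : exists a, a \oc tensl T p A = p \oc action Y.
  by apply: UA; rewrite -compmA -forget_alinear compmA pf comp0m.
have [||//|H /(_ tt)[q qE]] :=
  @entwined_final unit (fun=> Y) Q (fun=> p) d a => //.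
  by move=> W u v /(_ tt)/ep.
by exists (entwined_object H), q; rewrite qE.
Qed.

Lemma forget_kernel_reflect K X Y (i : mor K X) (f : mor X Y) :
  mono (tensl T (forget i) C) ->
  is_kernel (forget i) (forget f) -> is_kernel i f.
Proof.
move=> miC /kernelP[fi mi U]; apply/kernelP; split.
- exact: forget_inj.
- by move=> Z g h /(congr1 (@forget _ _)) /mi/forget_inj.
- move=> Z g gf; have [h ih] := U _ (forget g) (congr1 (@forget _ _) gf).
  have [||h' h'E] := @forget_full Z K h.
  + apply: miC; rewrite [RHS]compmA -tenslM ih -forget_colinear -ih.
    by rewrite !compmA -forget_colinear.
  + apply: mi; rewrite !compmA forget_alinear ih -compmA -tenslM ih.
    exact: forget_alinear.
  by exists h'; apply: forget_inj; rewrite forgetM h'E.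
Qed.

(** The action restricts because [i] is a kernel, the coaction because [i (x) C] is one; the axioms
    are inherited from [X]. *)
Lemma forget_kernel_lift X Y (f : mor X Y) K (i : mor K (carrier X)) :
  is_kernel i (forget f) -> is_kernel (tensl T i C) (tensl T (forget f) C) ->
  mono (tensl T (tensl T i C) C) ->
  exists L (j : mor L X), is_kernel (forget j) (forget f).
Proof.
move=> ki /kernelP[fiC miC UC] miCC; have /kernelP[fi mi U] := ki.
have [d di] : exists d, tensl T i C \oc d = coaction X \oc i.
  by apply: UC; rewrite compmA -forget_colinear -compmA fi compm0.
have [a ai] : exists a, i \oc a = action X \oc tensl T i A.
  by apply: U; rewrite compmA forget_alinear -compmA -tenslM fi tensl0 compm0.
have H := is_entwined_mono mi miC miCC (carrier_is_entwined X) (esym di) ai.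
have [||j jE] := @forget_full (entwined_object H) X i => //.
by exists (entwined_object H), j; rewrite jE.
Qed.

(** * Lifting and reflection of colimits *)

Section Colimits.
Variable J : smallcat.

Definition forget_diagram (D : diagram E J) : diagram S J :=
  @Diagram k S J (fun j => carrier (D j)) (fun i j a => forget (dmap D a))
    (fun i => congr1 (@forget _ _) (dmap1 D i))
    (fun i j l b a => congr1 (@forget _ _) (dmapM D b a)).

Lemma forget_colimit_reflect (D : diagram E J) L (c : forall j, mor (D j) L) :
  is_colimit (D := forget_diagram D) (fun j => forget (c j)) -> is_colimit c.
Proof.
move=> cL; apply: colimitI.
- by move=> i j a; apply: forget_inj; exact: (proj1 cL i j a).
- move=> X f g fg; apply: forget_inj; apply: (colimit_ext cL) => j.
  by rewrite -!forgetM fg.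
- move=> X d dC.
  have [|h hc] := @colimit_fact _ _ _ (forget_diagram D) _ _ _
    (fun j => forget (d j)) cL.
    by move=> i j a; rewrite -(dC _ _ a).
  have [||h' h'E] := @forget_final J _ L c X h d => //.
    by move=> W u v; exact: (colimit_ext cL).
  by exists h' => j; apply: forget_inj; rewrite forgetM h'E hc.
Qed.

Lemma forget_colimit_lift (D : diagram E J) :
  (exists L (c : forall j, mor (forget_diagram D j) L), is_colimit c) ->
  exists L (c : forall j, mor (D j) L),
    is_colimit (D := forget_diagram D) (fun j => forget (c j)).
Proof.
move=> [L [c cL]].
have [|d dc] := @colimit_fact _ _ _ (forget_diagram D) _ _ _
    (fun j => tensl T (c j) C \oc coaction (D j)) cL.
  move=> i j a; rewrite -compmA forget_colinear compmA -tenslM.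
  by rewrite (proj1 cL i j a).
have [|a ac] := @tensl_colimit_fact _ _ T _ (forget_diagram D) _ _ A _
    (fun j => c j \oc action (D j)) cL.
  move=> i j a; rewrite -compmA -forget_alinear compmA.
  by rewrite (proj1 cL i j a).
have cE : jointly_epi c by move=> W u v; exact: (colimit_ext cL).
have [H fE] := @entwined_final J D L c d a cE dc (fun j => esym (ac j)).
exists (entwined_object H), (fun j => sval (cid (fE j))).
suff -> : (fun j => forget (sval (cid (fE j)))) = c by [].
by apply: functional_extensionality_dep => j; exact: svalP (cid (fE j)).
Qed.

End Colimits.

(** * Exactness and colimits of entwined objects over a Grothendieck category *)

Hypothesis groS : is_grothendieck S.
Let abS := grothendieck_abelian groS.

Lemma forget_kernel_exists X Y (f : mor X Y) :
  exists K (i : mor K X), is_kernel (forget i) (forget f).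
Proof.
have [K [i ki]] := has_kernels abS (forget f).
apply: (forget_kernel_lift ki); first exact: tensl_kernel.
by do 2!apply: tensl_mono => //; exact: kernel_mono ki.
Qed.

Lemma forget_cokernel_exists X Y (f : mor X Y) :
  exists Q (p : mor Y Q), is_cokernel (forget p) (forget f).
Proof. exact/forget_cokernel_lift/(has_cokernels abS). Qed.

(** Preservation follows from lifting and reflection: any kernel is isomorphic to the one lifted
    from [S], by maps that are themselves morphisms of entwined objects. *)
Lemma forget_kernelE K X Y (i : mor K X) (f : mor X Y) :
  is_kernel (forget i) (forget f) <-> is_kernel i f.
Proof.
have R K' (i' : mor K' X) : is_kernel (forget i') (forget f) -> is_kernel i' f.
  move=> ki; apply: forget_kernel_reflect => //.
  exact: (tensl_mono groS (kernel_mono ki)).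
split=> [|/kernelP[fi mi U]]; first exact: R.
have [K0 [i0 ki0]] := forget_kernel_exists f.
have /kernelP[fi0 mi0 U0] := R _ _ ki0.
have [r ir] := U0 _ _ fi; have [s is_] := U _ _ fi0.
apply: (kernel_retract (r := forget r) (s := forget s) ki0).
- by rewrite -forgetM ir.
- by rewrite -forgetM is_.
- rewrite -forgetM -forget1; congr forget; apply: mi.
  by rewrite compmA is_ ir compm1.
Qed.

Lemma forget_cokernelE X Y Q (p : mor Y Q) (f : mor X Y) :
  is_cokernel (forget p) (forget f) <-> is_cokernel p f.
Proof.
split=> [|/cokernelP[pf ep U]]; first exact: forget_cokernel_reflect.
have [Q0 [p0 cp0]] := forget_cokernel_exists f.
have /cokernelP[pf0 ep0 U0] := forget_cokernel_reflect cp0.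
have [r rp] := U0 _ _ pf; have [s sp] := U _ _ pf0.
apply: (cokernel_retract (r := forget r) (s := forget s) cp0).
- by rewrite -forgetM rp.
- by rewrite -forgetM sp.
- rewrite -forgetM -forget1; congr forget; apply: ep.
  by rewrite -compmA sp rp comp1m.
Qed.

Lemma forget_mono X Y (f : mor X Y) : mono f -> mono (forget f).
Proof.
move=> mf; have [K [i /kernelP[fi mi U]]] := forget_kernel_exists f.
have i0 : i = 0 by apply: mf; rewrite compm0; apply: forget_inj.
by apply/mono0P => Z g /U[h <-]; rewrite i0 comp0m.
Qed.

Lemma forget_epi X Y (f : mor X Y) : epi f -> epi (forget f).
Proof.
move=> ef; have [Q [p /cokernelP[pf ep U]]] := forget_cokernel_exists f.
have p0 : p = 0 by apply: ef; rewrite comp0m; apply: forget_inj.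
by apply/epi0P => Z g /U[h <-]; rewrite p0 compm0.
Qed.

Lemma entwined_cocomplete : is_cocomplete E.
Proof.
move=> J D; have [L [c cL]] :=
  forget_colimit_lift (grothendieck_cocomplete groS (forget_diagram D)).
by exists L, c; exact: forget_colimit_reflect.
Qed.

Lemma forget_colimit (J : smallcat) (D : diagram E J) L
    (c : forall j, mor (D j) L) :
  is_colimit c -> is_colimit (D := forget_diagram D) (fun j => forget (c j)).
Proof.
move=> cL.
have [L0 [c0 c0S]] :=
  forget_colimit_lift (grothendieck_cocomplete groS (forget_diagram D)).
have c0L := forget_colimit_reflect c0S.
have [r rc] := colimit_fact c0L (proj1 cL).
have [s sc] := colimit_fact cL (proj1 c0L).
apply: (colimit_retract (r := forget r) (s := forget s) c0S) => [j|j|].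
- by rewrite -forgetM rc.
- by rewrite -forgetM sc.
- rewrite -forgetM -forget1; congr forget; apply: (colimit_ext cL) => j.
  by rewrite -compmA sc rc comp1m.
Qed.

Lemma entwined_abelian : is_abelian E.
Proof.
split.
- exact: cocomplete_zero_object entwined_cocomplete.
- by move=> X Y; exact: cocomplete_biproduct entwined_cocomplete.
- move=> X Y f; have [K [i ki]] := forget_kernel_exists f.
  by exists K, i; apply/forget_kernelE.
- move=> X Y f; have [Q [p cp]] := forget_cokernel_exists f.
  by exists Q, p; apply/forget_cokernelE.
- move=> X Y f /forget_mono mf; have [Q [p cp]] := forget_cokernel_exists f.
  by exists Q, p; apply/forget_kernelE; exact: mono_kernel_coker.
- move=> X Y f /forget_epi ef; have [K [i ki]] := forget_kernel_exists f.
  by exists K, i; apply/forget_cokernelE; exact: epi_coker_kernel.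
Qed.

Lemma entwined_filtered_exact (J : smallcat) :
  is_filtered J -> exact_colimits E J.
Proof.
move=> Jf D1 D2 D3 s t L1 L2 L3 c1 c2 c3 u v s_nat t_nat st l1 l2 l3 uE vE.
have [||j|j|j|ku cv] := grothendieck_filtered_exact groS Jf
  (D := forget_diagram D1) (E := forget_diagram D2) (F := forget_diagram D3)
  (s := fun j => forget (s j)) (t := fun j => forget (t j))
  (u := forget u) (v := forget v) _ _ _
  (forget_colimit l1) (forget_colimit l2) (forget_colimit l3).
- by move=> i j a; exact: (congr1 (@forget (D1 i) (D2 j)) (s_nat i j a)).
- by move=> i j a; exact: (congr1 (@forget (D2 i) (D3 j)) (t_nat i j a)).
- by have [ks ct] := st j; split; [apply/forget_kernelE|apply/forget_cokernelE].
- exact: (congr1 (@forget (D1 j) L2) (uE j)).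
- exact: (congr1 (@forget (D2 j) L3) (vE j)).
by split; [apply/forget_kernelE|apply/forget_cokernelE].
Qed.

End EntwinedCategory.

(** * The generator *)

Section Quotients.
Variables (k : fieldType) (S : klincat k).
Hypothesis abS : is_abelian S.
Variable G : S.
Hypothesis genG : is_generator G.

(* The kernel of [X -> Q] is determined by the maps from [G] it contains. *)
Lemma quotients_small (X : S) :
  exists (Q : (mor G X -> Prop) -> S) (e : forall P, mor X (Q P)),
    forall M (h : mor X M), exists P (j : mor (Q P) M),
      [/\ epi (e P), mono j & h = j \oc e P].
Proof.
pose good (P : mor G X -> Prop) Q (e : mor X Q) :=
  epi e /\ forall g, e \oc g = 0 <-> P g.
(* One quotient is chosen for each [P]; when no quotient of [X] has [P] as its set of killed maps,
   the identity of [X] serves as a default. *)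
have QP P : {Q & {e : mor X Q | (exists Q' e', @good P Q' e') -> good P Q e}}.
  have [/cid[Q /cid[e ge]]|no] := pselect (exists Q' e', @good P Q' e').
    by exists Q, e.
  by exists X, (idmor X).
exists (fun P => tag (QP P)), (fun P => sval (tagged (QP P))) => M h.
have [I [i [e [mi ee he]]]] := image_factorization abS h.
pose P (g : mor G X) := h \oc g = 0; exists P.
have ge : good P I e.
  split=> // g; rewrite /P he -compmA; split=> [->|]; first by rewrite compm0.
  by move=> ieg; apply: mi; rewrite ieg compm0.
have [|eP PE] := svalP (tagged (QP P)); first by exists I, e.
move: (tag (QP P)) (sval _) eP PE => Q p ep PE.
(* As [G] generates, a quotient killing the same maps from [G] as [e1] also kills the kernel of
   [e1]. *)
have factor Q1 Q2 (e1 : mor X Q1) (e2 : mor X Q2) :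
    good P Q1 e1 -> good P Q2 e2 -> exists u, e2 = u \oc e1.
  move=> [ee1 P1] [ee2 P2].
  have [K [l kl]] := has_kernels abS e1; have /kernelP[e1l _ _] := kl.
  have /cokernelP[_ _ U] := epi_coker_kernel abS ee1 kl.
  have [|u ue] := U _ e2; last by exists u.
  apply: genG => g; rewrite comp0m -compmA; apply/P2/P1.
  by rewrite compmA e1l comp0m.
have [u pu] := factor _ _ _ _ (conj ep PE) ge.
have [v ev] := factor _ _ _ _ ge (conj ep PE).
exists (i \oc u); split=> //; last by rewrite -compmA -pu.
apply: mono_comp => //; apply: (@split_mono _ _ _ _ u v); apply: ep.
by rewrite -compmA -pu -ev comp1m.
Qed.

End Quotients.

(** * The action of the dual of [C] on a comodule object *)

Section ConvolutionEvaluation.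
Variables (k : fieldType) (TV : tensoring (Mod k)).
Variables (S : klincat k) (T : tensoring S).

Lemma ev_ev_assocV (M : S) (V W : lmodType k) (phi : modhom k V (scalars k))
    (chi : modhom k W (scalars k)) :
  ev T M phi \oc ev T (T M V) chi \oc assocV TV T M V W
  = ev T M (phi \oc ev TV (V : Mod k) chi).
Proof.
apply: tens_ext2 => v w.
rewrite -compmA assocV_unit compmA -(compmA _ (ev _ _ chi)) ev_unit.
rewrite compmZ compm1.
rewrite compZm ev_unit ev_unit /= scalerA.
have := congr1 (fun f : linmap V V => f v) (ev_unit TV (V : Mod k) chi w).
by rewrite /= => ->; rewrite linearZ.
Qed.

(** Coassociativity read on functionals: acting by [chi], then by [phi], is acting by their
    convolution product. *)
Lemma ev_comodule (C : coalgebra TV) M (d : mor M (T M C))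
    (phi chi : modhom k C (scalars k)) : is_comodule_object d ->
  ev T M phi \oc d \oc ev T M chi \oc d
  = ev T M (phi \oc ev TV (coalg C : Mod k) chi \oc coalg_comul C) \oc d.
Proof.
move=> [dA _]; rewrite -ev_tensr -ev_ev_assocV.
rewrite (compm_sqr _ (esym (ev_natural _ _ _))).
by rewrite -[LHS]compmA -dA !compmA.
Qed.

End ConvolutionEvaluation.

Section Generator.
Variables (k : fieldType) (TV : tensoring (Mod k)).
Variables (S : klincat k) (T : tensoring S).
Variables (A : algebra TV) (C : coalgebra TV) (psi : mor (TV C A) (TV A C)).
Hypothesis groS : is_grothendieck S.
Let abS := grothendieck_abelian groS.

Notation E := (entwined_category T psi).
Notation dual := (modhom k C (scalars k)).

(** * The entwined subobject generated by a map *)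

Section Orbit.
Variables (M : E) (G : S) (x : mor G (carrier M)).
Local Notation d := (coaction M).
Local Notation m := (action M).

Lemma dual_orbit_exists :
  exists n : mor (T G dual) (carrier M),
    forall phi, n \oc tens_unit T G dual phi = ev T (carrier M) phi \oc d \oc x.
Proof. by apply: tens_fact => a phi chi; rewrite ev_linear !comp_linl. Qed.

Definition dual_orbit := sval (cid dual_orbit_exists).

Lemma dual_orbit_unit phi :
  dual_orbit \oc tens_unit T G dual phi = ev T (carrier M) phi \oc d \oc x.
Proof. exact: (svalP (cid dual_orbit_exists)). Qed.

Definition orbit : mor (T (T G dual) A) (carrier M) :=
  m \oc tensl T dual_orbit A.

(** The counit and the unit act as the identity, so [x] is the orbit map at these two elements. *)
Lemma orbit_gen :
  orbit \oc (tens_unit T (T G dual) A (alg_one A 1)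
    \oc tens_unit T G dual (coalg_counit C)) = x.
Proof.
have [[_ dE] [_ mE] _] := carrier_is_entwined M.
rewrite /orbit compmA (compm_sqr _ (tensl_unit _ _ _)) -compmA dual_orbit_unit.
rewrite /ev dE comp1m -tensr_unit compmA -/(runit T _).
by rewrite mE comp1m.
Qed.

(** With [q] the cokernel of the image, this says that the image is a subcomodule. After contraction
    by [phi], the map at [chi] is [q] applied to the action of a convolution product on [x], which
    stays in the orbit. *)
Lemma dual_orbit_stable W (q : mor (carrier M) W) :
  q \oc dual_orbit = 0 -> tensl T q C \oc d \oc dual_orbit = 0.
Proof.
move=> qn; apply: (ev_jointly_mono groS) => phi.
rewrite !compmA ev_natural; apply: tens_ext => chi; rewrite comp0m.
have [dP _ _] := carrier_is_entwined M.
transitivity (q \oc (ev T (carrier M) phi \oc d \oc ev T (carrier M) chi \oc d)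
    \oc x).
  by rewrite -[LHS]compmA dual_orbit_unit !compmA.
by rewrite (ev_comodule _ _ dP) -compmA -dual_orbit_unit compmA qn comp0m.
Qed.

Variables (Q : S) (j : mor Q (carrier M)) (e : mor (T (T G dual) A) Q).
Hypotheses (ee : epi e) (mj : mono j) (orbitE : orbit = j \oc e).

Lemma orbit_image_entwined :
  exists (dQ : mor Q (T Q C)) (aQ : mor (T Q A) Q) (H : is_entwined psi dQ aQ)
    (f : mor (entwined_object H : E) M), forget f = j.
Proof.
have Mst := carrier_is_entwined M; have [_ [mA _] dm] := Mst.
have [W [q cq]] := has_cokernels abS j.
have kj := mono_kernel_coker abS mj cq.
have /kernelP[qj _ Uj] := kj.
have /kernelP[_ mjC UjC] := tensl_kernel T C groS kj.
have qh : q \oc orbit = 0 by rewrite orbitE compmA qj comp0m.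
(* Stability under [A]: by associativity of the action, acting on the orbit map gives the orbit map
   again, precomposed with the multiplication. *)
have [aQ aQE] : exists a, j \oc a = m \oc tensl T j A.
  apply: Uj; apply: (tensl_epi (T := T) (V := A) ee).
  rewrite comp0m -!compmA -tenslM -orbitE /orbit tenslM.
  rewrite [m \oc _]compmA -mA -!compmA assoc_natural.
  rewrite [tensr _ _ _ \oc _]compmA -tensl_tensr -!compmA.
  by rewrite [m \oc _]compmA -/orbit compmA qh comp0m.
have [dQ dQE] : exists d', tensl T j C \oc d' = d \oc j.
  apply: UjC; apply: ee; rewrite comp0m -!compmA -orbitE.
  (* [N] is the image of [dual_orbit], and [d \oc dual_orbit] lands in [N (x) C]. The compatibility
     axiom moves the coaction past the action, so [d \oc orbit] lands in the image of [N (x) A],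
     tensored with [C], and [q] kills that image. *)
  have [N [jN [eN [mjN eeN nE]]]] := image_factorization abS dual_orbit.
  have [V [qN cqN]] := has_cokernels abS jN.
  have kjN := mono_kernel_coker abS mjN cqN; have /kernelP[qjN _ _] := kjN.
  have /kernelP[_ _ UN] := tensl_kernel T C groS kjN.
  have [|d' d'E] := UN _ (d \oc dual_orbit).
    by rewrite compmA dual_orbit_stable // nE compmA qjN comp0m.
  have qmN : q \oc m \oc tensl T jN A = 0.
    apply: (tensl_epi (T := T) (V := A) eeN).
    by rewrite -compmA -tenslM -nE -compmA -/orbit qh comp0m.
  have -> : d \oc orbit
      = tensl T (m \oc tensl T jN A) C \oc entwine T psi N \oc tensl T d' A.
    rewrite /orbit [LHS]compmA dm -[LHS]compmA -tenslM -d'E tenslM [LHS]compmA.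
    by rewrite (compm_sqr _ (entwine_natural _ _ _)) -tenslM.
  by rewrite [LHS]compmA [X in X \oc _]compmA -tenslM compmA qmN tensl0 !comp0m.
have H : is_entwined psi dQ aQ.
  apply: (is_entwined_mono mj mjC _ Mst (esym dQE) aQE).
  exact: (tensl_mono (T := T) (V := C) groS mjC).
exists dQ, aQ, H.
exact: (@forget_full _ _ _ _ _ _ _ (entwined_object H) M j (esym dQE) aQE).
Qed.

End Orbit.

Lemma entwined_generator : exists G : E, is_generator G.
Proof.
have [G genG] := grothendieck_generator groS.
have [Q [e QE]] := quotients_small abS genG (T (T G dual) A).
(* All entwined structures on all representative quotients; being built from predicates and
   morphisms only, the index type is small. *)
pose I := {P : mor G (T (T G dual) A) -> Prop &
  {s : mor (Q P) (T (Q P) C) * mor (T (Q P) A) (Q P)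
     | is_entwined psi s.1 s.2}}.
pose F (i : I) : E := entwined_object (proj2_sig (tagged i)).
have [L [c [cE cF]]] :=
  cocomplete_coproduct F (@entwined_cocomplete _ _ _ T A C psi groS).
exists L => M N f g fg; apply: forget_inj; apply: genG => x.
have [P [j [ee mj oE]]] := QE _ (orbit x).
have [dQ [aQ [H [u uj]]]] := orbit_image_entwined ee mj oE.
pose t : I := existT _ P (exist _ (dQ, aQ) H).
(* The family that is [u] at the index [t] and zero elsewhere extends to the coproduct, so maps
   agreeing on the coproduct agree after [u]. *)
pose d s : mor (F s) M := match pselect (t = s) with
  | left ts => eq_rect t (fun s => mor (F s) M) u s ts
  | right _ => 0 end.
have dt : d t = u.
  by rewrite /d; case: pselect => // tt; rewrite (Prop_irrelevance tt erefl).
have [h hc] := cF M d.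
have fu : forget f \oc j = forget g \oc j.
  have fdt : f \oc d t = g \oc d t by rewrite -hc !compmA fg.
  by rewrite -uj -dt; exact: (congr1 (@forget _ _ _ _ _ _ _ (F t) N) fdt).
by rewrite -(orbit_gen x) oE -!compmA [LHS]compmA [RHS]compmA fu.
Qed.

End Generator.

Theorem theorem2p6 (k : fieldType) (char0 : [pchar k] =i pred0)
    (TV : tensoring (Mod k)) (S : klincat k) (T : tensoring S)
    (S_grothendieck : is_grothendieck S)
    (A : algebra TV) (C : coalgebra TV) (psi : modhom k (TV C A) (TV A C))
    (psi_entwining : is_entwining psi) :
  is_grothendieck (entwined_category T psi).
Proof.
split.
- exact: entwined_abelian.
- exact: entwined_cocomplete.
- exact: entwined_filtered_exact.
- exact: entwined_generator.
Qed.
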